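(* Fix $\alpha>0$. For each prime $p$ let $\xi_p$ be an $\alpha$-balanced random variable in $\mathbb{F}_p$, and let $M=M_{n,p}$ be a random $n\times n$ matrix whose entries are iid copies of $\xi_p$. Then $$\lim_{p\to\infty}\ \lim_{n\to\infty}\mathbf{P}(M\text{ is eigenvalue-free})=\frac1e,$$ where $p$ tends to infinity along the primes.
   Context: A random variable $\xi$ taking values in $\mathbb{F}_p$ is called $\alpha$-balanced if $\max_{a\in\mathbb{F}_p}\mathbf{P}(\xi=a)\le 1-\alpha$. A matrix $M$ over $\mathbb{F}_p$ is eigenvalue-free if it has no eigenvalue in $\mathbb{F}_p$ (equivalently, no one-dimensional invariant subspace in $\mathbb{F}_p^n$). *)

(* Defs.v *)
From HB Require Import structures.
From mathcomp Require Import all_boot all_order all_algebra.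
From mathcomp Require Import all_classical all_reals all_analysis.
Set Implicit Arguments.
Unset Strict Implicit.
Unset Printing Implicit Defensive.
Import Order.TTheory GRing.Theory Num.Theory.
Import numFieldNormedType.Exports.

Local Open Scope classical_set_scope.
Local Open Scope ring_scope.
Local Open Scope ereal_scope.

(* Measurability with respect to the discrete sigma-algebra on V; below, V is
   a finite field, which carries no library measurableType structure. *)
Definition discrete_rv d (T : measurableType d) (V : Type) (X : T -> V) : Prop :=
  forall B : set V, measurable (X @^-1` B).

(* Since 'F_p is nonempty, the neutral element -oo does not affect the max. *)
Definition balanced d (T : measurableType d) (R : realType)
    (P : probability T R) (p : nat) (alpha : R) (X : T -> 'F_p) : Prop :=
  \big[maxe/-oo]_(a : 'F_p) P (X @^-1` [set a]) <= (1 - alpha)%:E.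

Definition same_distribution d1 (T1 : measurableType d1) d2
    (T2 : measurableType d2) (R : realType) (V : Type)
    (P1 : probability T1 R) (P2 : probability T2 R)
    (X1 : T1 -> V) (X2 : T2 -> V) : Prop :=
  forall B : set V, P1 (X1 @^-1` B) = P2 (X2 @^-1` B).

Definition mutually_independent d (T : measurableType d) (R : realType)
    (P : probability T R) (I : finType) (V : Type) (X : I -> T -> V) : Prop :=
  forall (J : {set I}) (B : I -> set V),
    P (\bigcap_(i in [set` J]) X i @^-1` B i) =
    \prod_(i in J) P (X i @^-1` B i).

Definition iid_copies_entries d1 (T1 : measurableType d1) d2
    (T2 : measurableType d2) (R : realType)
    (P1 : probability T1 R) (P2 : probability T2 R) (V : Type) (n : nat)
    (M : T1 -> 'M[V]_n) (xi : T2 -> V) : Prop :=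
  [/\ forall i j : 'I_n, discrete_rv (fun w => M w i j),
      forall i j : 'I_n, same_distribution P1 P2 (fun w => M w i j) xi &
      mutually_independent P1
        (fun (ij : 'I_n * 'I_n) (w : T1) => M w ij.1 ij.2)].

Definition eigenvalue_free (F : fieldType) (n : nat) (A : 'M[F]_n) : Prop :=
  forall a : F, ~~ eigenvalue A a.

(* Main.v *)
(** The proof is by moments at fixed p. If mu is the law of the entries, V A = D V
    is a condition on the columns of A separately, so that the expected number of
    full-rank k x n solutions V is a sum over V of products of probabilities that
    a mu-combination of the columns of V hits a given vector. A vector occurring
    often among the columns of V makes this probability nearly invariant under
    translation by it. For most V these vectors span F^k and the product is close
    to p^(-k n); otherwise the span is a proper subspace H, there are few columns
    outside H but at least one, and alpha-balancedness gains a factor q < 1 over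
    1/|H| in each of the n products. Hence the expectation tends to 1. For diagonal
    D these are q-factorial moments of the eigenspace sizes p^(N_a), and the
    indicator of N_a = 0 for all a is squeezed between truncations of the expansion
    prod_{i=1}^K (p^i - x) / (p^i - 1) = sum_{k <= K} c_k prod_{i < k} (x - p^i). *)
Require Import Defs.
From HB Require Import structures.
From mathcomp Require Import all_boot all_order all_algebra mxabelem.
From mathcomp Require Import all_classical all_reals all_analysis ring lra.
Set Implicit Arguments.
Unset Strict Implicit.
Unset Printing Implicit Defensive.
Import Order.TTheory GRing.Theory Num.Theory.
Import numFieldNormedType.Exports.

Local Open Scope ring_scope.

(** * Random combinations of vectors *)

Section Walk.
Variables (R : realFieldType) (F : finFieldType) (mu : F -> R).
Hypothesis mu_ge0 : forall a, 0 <= mu a.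
Hypothesis mu_sum1 : \sum_a mu a = 1.

(** The [N]-fold additive convolution of [mu]: the law of the total coefficient collected by a
    vector that occurs [N] times in a random combination. *)
Fixpoint walk_law (N : nat) : F -> R :=
  if N is N'.+1 then fun c => \sum_a mu a * walk_law N' (c - a)
  else fun c => (c == 0)%:R.

Lemma walk_law_ge0 N c : 0 <= walk_law N c.
Proof.
elim: N c => [|N IH] c /=; first exact: ler0n.
by apply: sumr_ge0 => a _; rewrite mulr_ge0.
Qed.

Lemma walk_law_sum1 N : \sum_c walk_law N c = 1.
Proof.
elim: N => [|N IH] /=.
  by rewrite (bigD1 0) //= eqxx big1 ?addr0 // => c /negPf ->.
rewrite exchange_big /= -mu_sum1; apply: eq_bigr => a _.
rewrite -mulr_sumr (reindex_inj (addIr a)) /=.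
by under eq_bigr do rewrite addrK; rewrite IH mulr1.
Qed.

Lemma walk_lawD m N c :
  walk_law (m + N) c = \sum_a walk_law m a * walk_law N (c - a).
Proof.
elim: m c => [|m IH] c /=.
  rewrite (bigD1 0) //= eqxx mul1r subr0 big1 ?addr0 // => a /negPf ->.
  by rewrite mul0r.
under eq_bigr => a _ do rewrite IH mulr_sumr.
under [RHS]eq_bigr => a _ do rewrite mulr_suml.
rewrite [RHS]exchange_big /=; apply: eq_bigr => a _.
rewrite [RHS](reindex_inj (addIr a)) /=.
by apply: eq_bigr => b _; rewrite addrK mulrA opprD addrA addrAC.
Qed.

Lemma walk_law_osc_le N t t' : `|walk_law N t - walk_law N t'| <= 1.
Proof.
have le1 c : walk_law N c <= 1.
  rewrite -(walk_law_sum1 N) (bigD1 c) //= lerDl.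
  by apply: sumr_ge0 => b _; apply: walk_law_ge0.
rewrite ler_norml lerBlDl lerBrDl; apply/andP; split.
  by rewrite (le_trans _ (walk_law_ge0 N t)) // subr_le0.
by rewrite (le_trans (le1 t)) // lerDr walk_law_ge0.
Qed.

(* Doeblin: if the m-step law has all its atoms at least eta, then m steps
   contract oscillations by the factor 1 - #|F| * eta. *)
Lemma walk_law_mixing m eta (eta_ge0 : 0 <= eta) :
  (forall c, eta <= walk_law m c) -> forall j N t t', (m * j <= N)%N ->
  `|walk_law N t - walk_law N t'| <= (1 - #|F|%:R * eta) ^+ j.
Proof.
move=> eta_le.
have step D N : (forall t t', `|walk_law N t - walk_law N t'| <= D) ->
    forall t t', `|walk_law (m + N) t - walk_law (m + N) t'|
      <= (1 - #|F|%:R * eta) * D.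
  move=> HD t t'; rewrite !walk_lawD -sumrB.
  (* Both translates of the law have total mass 1, so lowering every weight by [eta] leaves the
     difference unchanged; the weights stay nonnegative and now sum to [1 - #|F|%:R * eta]. *)
  have -> : \sum_a (walk_law m a * walk_law N (t - a)
                    - walk_law m a * walk_law N (t' - a)) =
      \sum_a (walk_law m a - eta) * (walk_law N (t - a) - walk_law N (t' - a)).
    under [RHS]eq_bigr => a _ do rewrite mulrBl.
    rewrite [RHS]sumrB -[in RHS]mulr_sumr [in X in _ = _ - eta * X]sumrB.
    have S u : \sum_a walk_law N (u - a) = 1.
      rewrite -(walk_law_sum1 N) [RHS](reindex_inj (inv_inj (subKr u))) /=.
      by [].
    rewrite !S subrr mulr0 subr0.
    by apply: eq_bigr => a _; rewrite mulrBr.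
  apply: le_trans (ler_norm_sum _ _ _) _.
  have -> : (1 - #|F|%:R * eta) * D = \sum_a (walk_law m a - eta) * D.
    rewrite -mulr_suml sumrB walk_law_sum1 sumr_const; congr (_ * _).
    by rewrite mulr_natl.
  apply: ler_sum => a _; rewrite normrM ger0_norm ?subr_ge0 //.
  by apply: ler_wpM2l; rewrite ?subr_ge0.
(* Extra steps only average, so they never increase the oscillation; this covers [N] beyond the
   multiple [m * j]. *)
have rest D N l : (forall t t', `|walk_law N t - walk_law N t'| <= D) ->
    forall t t', `|walk_law (l + N) t - walk_law (l + N) t'| <= D.
  move=> HD t t'; rewrite !walk_lawD -sumrB.
  apply: le_trans (ler_norm_sum _ _ _) _.
  rewrite -[D]mul1r -(walk_law_sum1 l) mulr_suml.
  apply: ler_sum => a _; rewrite -mulrBr normrM ger0_norm ?walk_law_ge0 //.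
  by apply: ler_wpM2l; rewrite ?walk_law_ge0.
have main j t t' : `|walk_law (m * j) t - walk_law (m * j) t'|
    <= (1 - #|F|%:R * eta) ^+ j.
  elim: j t t' => [|j IH] t t'; first by rewrite muln0 expr0 walk_law_osc_le.
  by rewrite mulnS exprS; apply: step.
by move=> j N t t' /subnK <-; apply: rest.
Qed.

(** A single path is kept: [i] steps equal to [a1] and [j] equal to [a0]. This supplies the
    minorization for Doeblin's argument over a prime field. *)
Lemma walk_law_two_atoms a0 a1 i j :
  mu a1 ^+ i * mu a0 ^+ j <= walk_law (i + j) (a1 *+ i + a0 *+ j).
Proof.
have lb a N c : mu a * walk_law N c <= walk_law N.+1 (c + a).
  rewrite /= (bigD1 a) //= addrK lerDl.
  by apply: sumr_ge0 => b _; rewrite mulr_ge0 // walk_law_ge0.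
elim: i => [|i IH].
  rewrite add0n expr0 mul1r mulr0n add0r; elim: j => [|j IH] /=.
    by rewrite mulr0n eqxx expr0.
  rewrite exprS mulrSr; apply: le_trans (lb _ _ _).
  by apply: ler_wpM2l.
rewrite addSn exprS mulrSr -mulrA addrAC; apply: le_trans (lb _ _ _).
by apply: ler_wpM2l.
Qed.

Variable k : nat.
Implicit Types (s : seq 'rV[F]_k) (v b : 'rV[F]_k).

Fixpoint comb_law s : 'rV[F]_k -> R :=
  if s is v :: s' then fun b => \sum_a mu a * comb_law s' (b - a *: v)
  else fun b => (b == 0)%:R.

Lemma comb_law_ge0 s b : 0 <= comb_law s b.
Proof.
elim: s b => [|v s IH] b /=; first exact: ler0n.
by apply: sumr_ge0 => a _; rewrite mulr_ge0.
Qed.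

Lemma comb_law_sum1 s : \sum_b comb_law s b = 1.
Proof.
elim: s => [|v s IH] /=.
  by rewrite (bigD1 0) //= eqxx big1 ?addr0 // => c /negPf ->.
rewrite exchange_big /= -mu_sum1; apply: eq_bigr => a _.
rewrite -mulr_sumr (reindex_inj (addIr (a *: v))) /=.
by under eq_bigr do rewrite addrK; rewrite IH mulr1.
Qed.

Lemma comb_law_le1 s b : comb_law s b <= 1.
Proof.
rewrite -(comb_law_sum1 s) (bigD1 b) //= lerDl.
by apply: sumr_ge0 => c _; apply: comb_law_ge0.
Qed.

(** The coefficients of all copies of [v] add up to a walk that is independent of the remaining
    vectors. *)
Lemma comb_law_filter s v b :
  comb_law s b = \sum_c walk_law (count_mem v s) c *
                   comb_law [seq w <- s | w != v] (b - c *: v).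
Proof.
elim: s b => [|w s IH] b /=.
  rewrite (bigD1 0) //= eqxx mul1r scale0r subr0 big1 ?addr0 // => c /negPf ->.
  by rewrite mul0r.
under eq_bigr => a _ do rewrite IH mulr_sumr.
have [->|wv] /= := eqVneq w v.
  under [RHS]eq_bigr => a _ do rewrite mulr_suml.
  rewrite exchange_big [RHS]exchange_big /= [LHS]exchange_big.
  apply: eq_bigr => a _; rewrite [RHS](reindex_inj (addIr a)) /=.
  by apply: eq_bigr => c _; rewrite addrK mulrA scalerDl opprD addrA addrAC.
rewrite add0n; under [RHS]eq_bigr => a _ do rewrite mulr_sumr.
rewrite exchange_big /=; apply: eq_bigr => c _; apply: eq_bigr => a _.
by rewrite mulrCA [b - _ - _]addrAC.
Qed.

(** Moving the target along [v] only moves the argument of the walk attached to [v], which costs at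
    most [D] for each of the [#|F|] values of that walk. *)
Lemma comb_law_shift s v b d D :
  (forall t t', `|walk_law (count_mem v s) t - walk_law (count_mem v s) t'| <= D) ->
  `|comb_law s (b + d *: v) - comb_law s b| <= #|F|%:R * D.
Proof.
move=> HD; rewrite !(comb_law_filter s v).
rewrite (reindex_inj (addIr d)) /= -sumrB.
apply: le_trans (ler_norm_sum _ _ _) _.
rewrite mulr_natl -sumr_const; apply: ler_sum => c _.
rewrite scalerDl opprD addrA [b + _ - _]addrAC addrK -mulrBl normrM.
rewrite [`|comb_law _ _|]ger0_norm ?comb_law_ge0 //.
by rewrite -[D]mulr1 ler_pM ?comb_law_ge0 ?comb_law_le1.
Qed.

(** Condition on all coefficients but that of one [v] outside [H]: distinct multiples of [v] lie in
    distinct cosets of [H], so at most one value of the last coefficient leads into the given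
    coset. *)
Lemma comb_law_coset_le (q : R) (H : {set 'rV[F]_k}) s b :
  (forall a, mu a <= q) ->
  {in H &, forall u v, u - v \in H} ->
  (forall c, {in H, forall v, c *: v \in H}) ->
  has [pred v | v \notin H] s ->
  \sum_(h in H) comb_law s (b + h) <= q.
Proof.
move=> muq HB HZ.
have q_ge0 : 0 <= q by apply: le_trans (mu_ge0 0) (muq 0).
elim: s b => [|v s IH] //= b.
rewrite exchange_big /= => Hs.
under eq_bigr => a _ do rewrite -mulr_sumr.
case: (boolP (has [pred v | v \notin H] s)) Hs => [hs _|_].
  rewrite -[q]mul1r -mu_sum1 mulr_suml; apply: ler_sum => a _.
  apply: ler_wpM2l => //; under eq_bigr do rewrite addrAC.
  exact: IH.
rewrite orbF => vH.
apply: (@le_trans _ _ (\sum_a q * \sum_(h in H) comb_law s (b + h - a *: v))).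
  apply: ler_sum => a _; apply: ler_wpM2r => //.
  by apply: sumr_ge0 => *; apply: comb_law_ge0.
rewrite -mulr_sumr -[leRHS]mulr1; apply: ler_wpM2l => //.
rewrite pair_big_dep /=.
pose f (x : F * 'rV[F]_k) := b + x.2 - x.1 *: v.
(* A collision would put a nonzero multiple of [v], hence [v] itself, into [H]; so the points met
   are distinct and their total mass is at most 1. *)
have f_inj : {in [pred x : F * 'rV[F]_k | x.2 \in H] &, injective f}.
  move=> [a h] [a' h'] /=; rewrite !inE /f /= => hH h'H.
  rewrite -!addrA => /addrI e.
  have e' : (a - a') *: v = h - h'.
    rewrite scalerBl -[h](subrK (a *: v)) e [RHS]addrAC [h' - _ - h']addrAC.
    by rewrite subrr add0r addrC.
  have [aa|aa] := eqVneq a a'; last first.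
    case/negP: vH; rewrite -[v](scalerK (a := a - a')) ?subr_eq0 // e'.
    by apply: HZ; apply: HB.
  by move/esym/eqP: e'; rewrite aa subrr scale0r subr_eq0 => /eqP ->.
have -> : \sum_(x : F * 'rV[F]_k | x.2 \in H) comb_law s (b + x.2 - x.1 *: v) =
    \sum_(y in f @: [pred x : F * 'rV[F]_k | x.2 \in H]) comb_law s y.
  by rewrite big_imset.
rewrite -(comb_law_sum1 s) [leRHS](bigID [in f @: [pred x : F * 'rV[F]_k | x.2 \in H]]) /=.
by rewrite lerDl sumr_ge0 // => *; apply: comb_law_ge0.
Qed.

(** * Near-invariance along the span of the frequent vectors *)

Definition frequent_span m s : {set 'rV[F]_k} :=
  [set v | v \in <<[seq w <- enum 'rV[F]_k | (m <= count_mem w s)%N]>>%VS].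

Lemma frequent_span0 m s : 0 \in frequent_span m s.
Proof. by rewrite inE mem0v. Qed.

Lemma frequent_spanD m s : {in frequent_span m s &, forall u v, u + v \in frequent_span m s}.
Proof. by move=> u v; rewrite !inE => uH vH; rewrite memvD. Qed.

Lemma frequent_spanB m s : {in frequent_span m s &, forall u v, u - v \in frequent_span m s}.
Proof. by move=> u v; rewrite !inE => uH vH; rewrite memvB. Qed.

Lemma frequent_spanZ m s (c : F) : {in frequent_span m s, forall v, c *: v \in frequent_span m s}.
Proof. by move=> v; rewrite !inE => vH; rewrite memvZ. Qed.

(** A vector outside the span occurs fewer than [m] times, and there are at most [#|'rV[F]_k|] such
    vectors. *)
Lemma frequent_span_count m s :
  (count [pred v | v \notin frequent_span m s] s <= #|'rV[F]_k| * m)%N.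
Proof.
have cE (A : pred 'rV[F]_k) t : count A t = (\sum_(v | A v) count_mem v t)%N.
  elim: t => [|w t IH] /=; first by rewrite big1.
  rewrite big_split /= -IH; congr (_ + _)%N.
  case: (boolP (A w)) => Aw.
    by rewrite (bigD1 w) //= eqxx big1 // => v /andP[_ /negPf vw]; rewrite eq_sym vw.
  by rewrite big1 // => v Av; case: eqVneq => // e; rewrite e Av in Aw.
rewrite cE -sum_nat_const.
rewrite [leqRHS](bigID [pred v | v \notin frequent_span m s]) /=.
apply: leq_trans (leq_addr _ _); apply: leq_sum => v.
rewrite inE => /negP vH; rewrite ltnW // ltnNge; apply/negP => hm; apply: vH.
by apply: memv_span; rewrite mem_filter hm mem_enum.
Qed.

Section Near.
Variables (m : nat) (D : R) (s : seq 'rV[F]_k).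
Hypothesis osc_le : forall N t t', (m <= N)%N -> `|walk_law N t - walk_law N t'| <= D.

Let eps := #|'rV[F]_k|%:R * (#|F|%:R * D).

(** Write [h] as a combination of frequent vectors and move along one of them at a time, each move
    costing [#|F|%:R * D]. *)
Lemma comb_law_frequent_shift b h : h \in frequent_span m s ->
  `|comb_law s (b + h) - comb_law s b| <= eps.
Proof.
rewrite inE; set X := seq.filter _ _ => hX.
have D_ge0 : 0 <= #|F|%:R * D.
  by rewrite mulr_ge0 ?ler0n // (le_trans (normr_ge0 _) (osc_le 0 0 (leqnn m))).
rewrite (coord_span (X := in_tuple X) hX).
have main r b' : `|comb_law s (b' + \sum_(i <- r) coord (in_tuple X) i h *: X`_i)
    - comb_law s b'| <= (size r)%:R * (#|F|%:R * D).
  elim: r b' => [|i r IH] b'.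
    by rewrite big_nil addr0 subrr normr0 mul0r.
  rewrite big_cons addrA /= -natr1 mulrDl mul1r.
  set c := coord _ _ _; set S := \sum_(j <- r) _.
  rewrite -(subrKA (comb_law s (b' + c *: X`_i))).
  apply: le_trans (ler_normD _ _) _; apply: lerD; first exact: IH.
  apply: comb_law_shift => t t'; apply: osc_le.
  have : X`_i \in X by rewrite mem_nth.
  by rewrite mem_filter => /andP[].
apply: le_trans (main _ _) _; rewrite /eps ler_wpM2r // ler_nat.
rewrite /index_enum -enumT -cardT card_ord.
by rewrite cardE size_filter count_size.
Qed.

Lemma comb_law_frequent_average b :
  `|#|frequent_span m s|%:R * comb_law s b -
    \sum_(h in frequent_span m s) comb_law s (b + h)|
  <= #|frequent_span m s|%:R * eps.
Proof.
rewrite !mulr_natl -!sumr_const -sumrB.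
apply: le_trans (ler_norm_sum _ _ _) _; apply: ler_sum => h hH.
by rewrite distrC comb_law_frequent_shift.
Qed.

(** The coset of [b] has mass at most [q], and near-invariance spreads this mass almost evenly over
    its points. *)
Lemma comb_law_frequent_le q b : (forall a, mu a <= q) ->
  has [pred v | v \notin frequent_span m s] s ->
  comb_law s b <= q / #|frequent_span m s|%:R + eps.
Proof.
move=> muq hs; have := comb_law_frequent_average b.
set H := frequent_span m s.
have H0 : 0 < #|H|%:R :> R.
  by rewrite ltr0n; apply/card_gt0P; exists 0; apply: frequent_span0.
rewrite ler_norml => /andP[_]; rewrite lerBlDl => le1.
rewrite -(ler_pM2l H0) (le_trans le1) // mulrDr lerD2r mulrCA divff ?gt_eqF // mulr1.
apply: comb_law_coset_le => //; first exact: frequent_spanB.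
by move=> c v; apply: frequent_spanZ.
Qed.

Lemma comb_law_frequent_full b : frequent_span m s = [set: 'rV[F]_k] ->
  `|comb_law s b - #|'rV[F]_k|%:R^-1| <= eps.
Proof.
move=> HT; have := comb_law_frequent_average b.
have -> : \sum_(h in frequent_span m s) comb_law s (b + h) = 1.
  rewrite HT -(comb_law_sum1 s) [RHS](reindex_inj (addrI b)) /=.
  by apply: eq_bigl => h; rewrite inE.
rewrite HT cardsT; set g := #|_|%:R.
have g0 : 0 < g :> R by rewrite ltr0n; apply/card_gt0P; exists 0.
rewrite -[X in _ - X](divff (x := g)) ?gt_eqF // -mulrBr normrM gtr0_norm //.
by rewrite ler_pM2l.
Qed.
End Near.

(** * Intertwiners of a random matrix *)

Lemma sum_rV_recl n (f : 'rV[F]_n.+1 -> R) :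
  \sum_x f x = \sum_a \sum_(y : 'rV[F]_n) f (\row_j oapp (y 0) a (unlift 0 j)).
Proof.
rewrite pair_big /=.
rewrite (reindex (fun z : F * 'rV[F]_n => \row_j oapp (z.2 0) z.1 (unlift 0 j))) //=.
exists (fun x : 'rV[F]_n.+1 => (x 0 0, col' 0 x)) => [[a y] _ | x _] /=.
  rewrite mxE unlift_none /=; congr (_, _).
  by apply/rowP => j; rewrite !mxE liftK.
apply/rowP => j; rewrite mxE; case: unliftP => [j'|] -> //=.
by rewrite mxE.
Qed.

Definition rows n (W : 'M[F]_(n, k)) : seq 'rV[F]_k := [seq row i W | i <- enum 'I_n].

Lemma comb_law_rows n (W : 'M[F]_(n, k)) b :
  comb_law (rows W) b =
  \sum_(x : 'rV[F]_n) (\prod_i mu (x 0 i)) * (x *m W == b)%:R.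
Proof.
elim: n W b => [|n IH] W b.
  rewrite /rows enum_ord0 /= (bigD1 0) //= big_ord0 mul1r mul0mx eq_sym.
  by rewrite big1 ?addr0 // => x /eqP; case; apply/rowP => -[].
rewrite /rows enum_ordSl /= sum_rV_recl; apply: eq_bigr => a _.
have -> : [seq row i W | i <- [seq lift ord0 i | i <- enum 'I_n]] = rows (row' 0 W).
  by rewrite -map_comp; apply: eq_map => i /=; apply/rowP => j; rewrite !mxE.
rewrite IH mulr_sumr; apply: eq_bigr => y _.
rewrite big_ord_recl mxE unlift_none /= mulrA; congr (_ * _ * _).
  by apply: eq_bigr => i _; rewrite mxE liftK.
congr (nat_of_bool _)%:R; rewrite eq_sym subr_eq eq_sym; congr (_ == _).
apply/rowP => j; rewrite !mxE big_ord_recl !mxE unlift_none addrC /=; congr (_ + _).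
by apply: eq_bigr => i _; rewrite !mxE liftK.
Qed.

Definition mx_mass n (A : 'M[F]_n) : R := \prod_i \prod_j mu (A i j).

(** After exchanging the sums, [V *m A == D *m V] splits into one condition per column of [A], and
    the columns are independent under [mx_mass]. *)
Lemma mx_mass_intertwiner n (D : 'M[F]_k) :
  \sum_(A : 'M[F]_n) mx_mass A *
    #|[set V : 'M[F]_(k, n) | row_free V && (V *m A == D *m V)]|%:R =
  \sum_(V : 'M[F]_(k, n) | row_free V)
    \prod_j comb_law (rows V^T) (row j (D *m V)^T).
Proof.
transitivity (\sum_(A : 'M[F]_n) \sum_(V : 'M[F]_(k, n) | row_free V)
    mx_mass A * (V *m A == D *m V)%:R).
  apply: eq_bigr => A _; rewrite -mulr_sumr; congr (_ * _).
  rewrite -sum1_card natr_sum big_mkcond [RHS]big_mkcond /=.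
  by apply: eq_bigr => V _; rewrite inE; case: row_free => //=; case: eqP.
rewrite exchange_big /=; apply: eq_bigr => V _.
under [RHS]eq_bigr => j _ do rewrite comb_law_rows.
rewrite bigA_distr_bigA /=.
rewrite (reindex (fun f : {ffun 'I_n -> 'rV[F]_n} => (\matrix_i f i)^T)) /=; last first.
  exists (fun A => [ffun i => row i A^T]) => [f _|A _].
    by apply/ffunP => i; rewrite ffunE trmxK rowK.
  by apply/trmx_inj; apply/row_matrixP => i; rewrite trmxK rowK ffunE.
apply: eq_bigr => f _; rewrite big_split /=; congr (_ * _).
  rewrite /mx_mass exchange_big; apply: eq_bigr => i _; apply: eq_bigr => j _.
  by rewrite !mxE.
rewrite -(inj_eq trmx_inj) trmx_mul trmxK.
transitivity ([forall j, f j *m V^T == row j (D *m V)^T]%:R : R).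
  congr (nat_of_bool _)%:R; apply/eqP/forallP => [e j|e].
    by rewrite -e row_mul rowK.
  by apply/row_matrixP => j; rewrite row_mul rowK; apply/eqP.
case: forallP => [e|/forallP].
  by rewrite big1 // => j _; rewrite e.
rewrite negb_forall => /existsP[j /negPf e].
by rewrite (bigD1 j) //= e mul0r.
Qed.
Lemma sum_mx_cols n (f : 'M[F]_(k, n) -> R) :
  \sum_V f V = \sum_(g : {ffun 'I_n -> 'rV[F]_k}) f (\matrix_i g i)^T.
Proof.
rewrite (reindex (fun g : {ffun 'I_n -> 'rV[F]_k} => (\matrix_i g i)^T)) //=.
exists (fun V : 'M[F]_(k, n) => [ffun i => row i V^T]) => [g _|V _].
  by apply/ffunP => i; rewrite ffunE trmxK rowK.
by apply/trmx_inj; apply/row_matrixP => i; rewrite trmxK rowK ffunE.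
Qed.

(* Chernoff's bound for the number of matrices with few columns outside H. *)
Lemma card_few_cols_out n c (t : R) (H : {set 'rV[F]_k}) : 0 < t -> t <= 1 ->
  \sum_(V : 'M[F]_(k, n) | (count [pred v | v \notin H] (rows V^T) <= c)%N) 1
  <= t ^- c * (#|H|%:R + t * #|'rV[F]_k|%:R) ^+ n.
Proof.
move=> t0 t1; rewrite ler_pdivlMl ?exprn_gt0 //.
apply: (@le_trans _ _ (\sum_(V : 'M[F]_(k, n))
    t ^+ count [pred v | v \notin H] (rows V^T))).
  rewrite mulr_sumr [leRHS](bigID [pred V : 'M[F]_(k, n) |
    (count [pred v | v \notin H] (rows V^T) <= c)%N]) /=.
  rewrite -[leLHS]addr0 lerD //; last by apply: sumr_ge0 => V _; rewrite exprn_ge0 // ltW.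
  by apply: ler_sum => V Vc; rewrite mulr1 ler_wiXn2l // ltW.
rewrite sum_mx_cols.
have -> : #|H|%:R + t * #|'rV[F]_k|%:R =
    \sum_(v in H) 1 + t * \sum_(v : 'rV[F]_k) 1 :> R by rewrite !sumr_const.
apply: (@le_trans _ _ (\prod_(i < n) \sum_(v : 'rV[F]_k) t ^+ (v \notin H))).
  rewrite bigA_distr_bigA /=; apply: ler_sum => g _.
  rewrite trmxK /rows count_map -sum1_count big_mkcond big_enum /= expr_sum.
  by apply: ler_prod => i _; rewrite rowK exprn_ge0 ?(ltW t0) //=; case: (_ \in _).
rewrite prodr_const card_ord; apply: lerXn2r; rewrite ?nnegrE.
- by apply: sumr_ge0 => v _; rewrite exprn_ge0 // ltW.
- by rewrite addr_ge0 ?mulr_ge0 ?sumr_ge0 // ltW.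
rewrite (bigID [in H]) /=; apply: lerD; first by apply: ler_sum => v ->.
rewrite mulr_sumr [leRHS](bigID [in H]) /= -[leLHS]add0r lerD //.
  by apply: sumr_ge0 => v _; rewrite mulr1 ltW.
by apply: ler_sum => v ->; rewrite mulr1.
Qed.

(** * Bounds for the mean number of full-rank intertwiners *)

Section Bound.
Variables (n m : nat) (D q t : R) (E : 'M[F]_k).
Hypothesis osc_le : forall N u u', (m <= N)%N -> `|walk_law N u - walk_law N u'| <= D.
Let g : R := #|'rV[F]_k|%:R.
Let eps : R := g * (#|F|%:R * D).
Hypothesis mu_le : forall a, mu a <= q.
Hypothesis index_le : 1 - g^-1 <= q.
Hypothesis t_gt0 : 0 < t.
Hypothesis t_le1 : t <= 1.

(** Bounds the contribution of one proper span [H]: the column bound [(q / #|H|%:R + eps) ^+ n]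
    times the Chernoff count with [#|'rV[F]_k| * m] exceptional columns, made uniform by
    [1 <= #|H| <= g]. *)
Let bad : R := ((q + g * eps) * (1 + t * g)) ^+ n * t ^- (#|'rV[F]_k| * m).
Let nsub : R := #|{set 'rV[F]_k}|%:R.

Let term (V : 'M[F]_(k, n)) := \prod_j comb_law (rows V^T) (row j (E *m V)^T).
Let span_of (V : 'M[F]_(k, n)) := frequent_span m (rows V^T).

Let g_ge1 : 1 <= g.
Proof. by rewrite ler1n; apply/card_gt0P; exists 0. Qed.

Let g_gt0 : 0 < g.
Proof. exact: lt_le_trans ltr01 g_ge1. Qed.

Let g_ge0 : 0 <= g.
Proof. exact: ltW. Qed.

Let t_ge0 : 0 <= t.
Proof. exact: ltW. Qed.

Let eps_ge0 : 0 <= eps.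
Proof.
rewrite mulr_ge0 ?mulr_ge0 ?ler0n //.
by rewrite (le_trans (normr_ge0 _) (osc_le 0 0 (leqnn m))).
Qed.

Let q_ge0 : 0 <= q.
Proof. by rewrite (le_trans (mu_ge0 0) (mu_le 0)). Qed.

Let qeps_ge0 : 0 <= q + g * eps.
Proof. exact/addr_ge0/mulr_ge0. Qed.

Let tg_ge0 : 0 <= t * g.
Proof. exact: mulr_ge0. Qed.

Let tg1_gt0 : 0 < 1 + t * g.
Proof. exact: ltr_pwDl. Qed.

Let bad_ge0 : 0 <= bad.
Proof.
apply: mulr_ge0; last by rewrite invr_ge0 exprn_ge0.
exact/exprn_ge0/mulr_ge0/ltW.
Qed.

(** The columns of a full-rank [V] span the whole space, so they cannot all lie in a proper
    subspace. *)
Lemma row_free_col_out V : row_free V -> span_of V != [set: 'rV[F]_k] ->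
  has [pred v | v \notin span_of V] (rows V^T).
Proof.
move=> Vf; apply: contraR => /hasPn allin; apply/eqP/finset.setP => u; rewrite finset.in_setT.
have /submxP[w ->] : (u <= V^T)%MS.
  by apply: submx_full; rewrite /row_full mxrank_tr.
rewrite mulmx_sum_row; elim/big_ind: _ => [|x y xH yH|i _].
- exact: frequent_span0.
- exact: frequent_spanD.
apply: frequent_spanZ; have := allin (row i V^T); rewrite /= negbK; apply.
by apply: map_f; rewrite mem_enum.
Qed.

(** A union bound over the possible spans [H], crudely over all subsets; for each one,
    [frequent_span_count] makes the Chernoff count applicable. *)
Lemma sum_span_le (c : {set 'rV[F]_k} -> R) (Q : pred {set 'rV[F]_k}) (B : R) :
  (forall H, 0 <= c H) -> 0 <= B ->
  (forall H, Q H -> 0 \in H ->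
    c H * (t ^- (#|'rV[F]_k| * m) * (#|H|%:R + t * g) ^+ n) <= B) ->
  \sum_(V | Q (span_of V)) c (span_of V) <= nsub * B.
Proof.
move=> c0 B0 cB; rewrite mulr_natl -sumr_const.
rewrite (partition_big span_of predT) //=; apply: ler_sum => H _.
have [H0|H0] := boolP (0 \in H); last first.
  rewrite big_pred0 // => V; apply/negP => /andP[_ /eqP e].
  by case/negP: H0; rewrite -e frequent_span0.
have [QH|QH] := boolP (Q H); last first.
  rewrite big_pred0 // => V; apply/negP => /andP[Q' /eqP e].
  by case/negP: QH; rewrite -e.
apply: le_trans (cB H QH H0).
apply: le_trans (ler_wpM2l (c0 H) (card_few_cols_out _ _ _ t_gt0 t_le1)).
rewrite mulr_sumr big_mkcond [leRHS]big_mkcond /=; apply: ler_sum => V _.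
case: andP => [[_ /eqP <-]|_].
  by rewrite mulr1 frequent_span_count.
by case: ifP => //; rewrite mulr1.
Qed.

Lemma bad_sum_le : \sum_(V | row_free V && (span_of V != finset.setT)) term V <= nsub * bad.
Proof.
pose c (H : {set 'rV[F]_k}) : R := (q / #|H|%:R + eps) ^+ n.
apply: (@le_trans _ _ (\sum_(V | span_of V != finset.setT) c (span_of V))).
  rewrite big_mkcond [leRHS]big_mkcond /=; apply: ler_sum => V _.
  have c0 : 0 <= c (span_of V) by rewrite exprn_ge0 // addr_ge0 // divr_ge0 ?ler0n.
  case: (boolP (span_of V != _)) => [HT|_]; last by rewrite andbF.
  rewrite andbT; case: (boolP (row_free V)) => // Vf.
  rewrite /c -[n in _ ^+ n]card_ord -prodr_const; apply: ler_prod => j _.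
  rewrite comb_law_ge0 comb_law_frequent_le //.
  exact: row_free_col_out.
apply: (@sum_span_le c (fun H => H != finset.setT)) => // [H|H _ H0].
  by rewrite exprn_ge0 // addr_ge0 // divr_ge0 ?ler0n.
have h1 : 1 <= #|H|%:R :> R by rewrite ler1n; apply/card_gt0P; exists 0.
have hg : #|H|%:R <= g by rewrite ler_nat max_card.
have h0 : 0 < #|H|%:R :> R := lt_le_trans ltr01 h1.
rewrite /c /bad mulrCA mulrC ler_wpM2r //.
  by rewrite invr_ge0 exprn_ge0.
rewrite -exprMn lerXn2r ?nnegrE //.
- by rewrite mulr_ge0 // addr_ge0 // divr_ge0.
- exact/mulr_ge0/ltW.
(* Shifting the factor [#|H|%:R] between the brackets makes the first increasing and the second
   decreasing in [#|H|], so each is bounded at an end of the range from 1 to [g]. *)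
have -> : (q / #|H|%:R + eps) * (#|H|%:R + t * g) =
    (q + #|H|%:R * eps) * (1 + t * g / #|H|%:R).
  by field; rewrite gt_eqF.
apply: ler_pM.
- by apply: addr_ge0 => //; apply: mulr_ge0.
- by apply: addr_ge0 => //; apply: divr_ge0.
- by rewrite lerD2l ler_wpM2r.
by rewrite lerD2l ler_pdivrMr // ler_peMr.
Qed.

(** A proper subset has at most [g - 1] points, a proportion at most [q] by [index_le]; hence the
    same [bad] also controls the proportion of matrices [V] without full span. *)
Lemma card_bad_le :
  \sum_(V : 'M[F]_(k, n) | span_of V != finset.setT) 1 <= nsub * (bad * g ^+ n).
Proof.
apply: (@sum_span_le (fun=> 1) (fun H => H != finset.setT)) => // [|H HT H0].
  exact/mulr_ge0/exprn_ge0.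
have h1 : 1 <= #|H|%:R :> R by rewrite ler1n; apply/card_gt0P; exists 0.
have hg : #|H|%:R <= g - 1.
  rewrite lerBrDr natr1 ler_nat -cardsT proper_card // finset.properEneq HT.
  exact: finset.subsetT.
rewrite mul1r /bad mulrC mulrAC ler_wpM2r //.
  by rewrite invr_ge0 exprn_ge0.
rewrite -exprMn lerXn2r ?nnegrE //.
- by rewrite addr_ge0 ?ler0n.
- by apply: mulr_ge0 => //; apply/mulr_ge0/ltW.
apply: (@le_trans _ _ ((g - 1) * (1 + t * g))).
  rewrite [leRHS]mulrDr mulr1 lerD // ler_peMl // (le_trans h1) //.
rewrite mulrAC ler_wpM2r ?addr_ge0 //.
apply: (@le_trans _ _ (q * g)); last by rewrite ler_wpM2r ?lerDl //; apply: mulr_ge0.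
by move: index_le; rewrite -(ler_pM2r g_gt0) mulrBl mul1r mulVf ?gt_eqF.
Qed.

Lemma intertwiner_sum_le :
  \sum_(V | row_free V) term V <= (1 + g * eps) ^+ n + nsub * bad.
Proof.
rewrite (bigID (fun V => span_of V == finset.setT)) /=; apply: lerD; last exact: bad_sum_le.
have -> : (1 + g * eps) ^+ n = \sum_(V : 'M[F]_(k, n)) (g^-1 + eps) ^+ n.
  rewrite sumr_const card_mx -mulr_natl natrX exprM -exprMn.
  rewrite mulrDr /g card_mx mul1n natrX mulfV //.
  by have := gt_eqF g_gt0; rewrite /g card_mx mul1n natrX => ->.
rewrite [leRHS](bigID (fun V => row_free V && (span_of V == finset.setT))) /=.
rewrite -[leLHS]addr0 lerD //; last first.
  by apply: sumr_ge0 => V _; rewrite exprn_ge0 // addr_ge0 // invr_ge0.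
apply: ler_sum => V /andP[_ /eqP HT]; rewrite -[n in _ ^+ n]card_ord -prodr_const.
apply: ler_prod => j _; rewrite comb_law_ge0 /=.
have := comb_law_frequent_full osc_le (row j (E *m V)^T) HT.
by rewrite ler_norml lerBlDl => /andP[].
Qed.

Lemma row_free_of_span V : (0 < m)%N -> span_of V = finset.setT -> row_free V.
Proof.
move=> m0 /finset.setP HT; rewrite -row_leq_rank.
suff: (\rank (1%:M : 'M[F]_k) <= \rank V^T)%N by rewrite mxrank1 mxrank_tr.
apply: mxrankS; apply/row_subP => i.
have := HT (row i 1%:M); rewrite finset.in_setT inE; set X := seq.filter _ _ => hX.
rewrite (coord_span (X := in_tuple X) hX); apply: summx_sub => j _; apply: scalemx_sub.
have : X`_j \in X by rewrite mem_nth.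
rewrite mem_filter => /andP[/(leq_trans m0)]; rewrite -has_count => /hasP[w].
by case/mapP => l _ -> /eqP <- _; apply: row_sub.
Qed.

(** Only the [V] with full span are kept; they are automatically of full rank, and all but a [bad]
    proportion of matrices are of this kind. The condition on [eps] keeps the lower bound
    [g^-1 - eps] of each factor nonnegative. *)
Lemma intertwiner_sum_ge : (0 < m)%N -> g * eps <= 1 ->
  (1 - g * eps) ^+ n - nsub * bad <= \sum_(V | row_free V) term V.
Proof.
move=> m0 eps1.
have t0 V : 0 <= term V by apply: prodr_ge0 => j _; apply: comb_law_ge0.
have e0 : 0 <= g^-1 - eps by rewrite subr_ge0 -(ler_pM2l g_gt0) mulfV ?gt_eqF.
apply: (@le_trans _ _ (\sum_(V | span_of V == finset.setT) term V)); last first.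
  rewrite [leRHS](bigID (fun V => span_of V == finset.setT)) /=.
  rewrite -[leLHS]addr0 lerD //; last exact: sumr_ge0.
  rewrite big_mkcond [leRHS]big_mkcond /=; apply: ler_sum => V _.
  case: eqP => [HT|]; last by rewrite andbF.
  by rewrite andbT row_free_of_span.
apply: (@le_trans _ _ (\sum_(V | span_of V == finset.setT) (g^-1 - eps) ^+ n)); last first.
  apply: ler_sum => V /eqP HT; rewrite -[n in _ ^+ n]card_ord -prodr_const.
  apply: ler_prod => j _; rewrite e0 /=.
  have := comb_law_frequent_full osc_le (row j (E *m V)^T) HT.
  by rewrite ler_norml lerBrDl => /andP[].
have eE : \sum_(V : 'M[F]_(k, n)) (g^-1 - eps) ^+ n = (1 - g * eps) ^+ n.
  rewrite sumr_const card_mx -mulr_natl natrX exprM -exprMn.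
  rewrite mulrBr /g card_mx mul1n natrX mulfV //.
  by have := gt_eqF g_gt0; rewrite /g card_mx mul1n natrX => ->.
rewrite -eE (bigID (fun V => span_of V == finset.setT)) /= -addrA gerDl subr_le0.
under eq_bigr => V _ do rewrite -[(_ - _) ^+ n]mulr1.
rewrite -mulr_sumr (le_trans (ler_wpM2l _ card_bad_le)) ?exprn_ge0 //.
rewrite mulrCA ler_wpM2l ?ler0n // mulrCA -exprMn mulrBl mulVf ?gt_eqF //.
by rewrite ler_piMr // exprn_ile1 // ?subr_ge0 1?mulrC // lerBlDr lerDl; apply: mulr_ge0.
Qed.
End Bound.
End Walk.

(** * Independent families of eigenvectors *)

Section EigenFrames.
Variables (F : finFieldType) (n : nat) (A : 'M[F]_n).

Definition eigen_card (a : F) : nat := #|[set v : 'rV[F]_n | v *m A == a *: v]|.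

Definition diag_seq (e : seq F) : 'M[F]_(size e) := diag_mx (\row_i e`_i).

Definition eigenframes (e : seq F) : {set 'M[F]_(size e, n)} :=
  [set V | row_free V && (V *m A == diag_seq e *m V)].

Lemma row_free_col_mx1 k (v : 'rV[F]_n) (V : 'M[F]_(k, n)) :
  row_free (col_mx v V) = row_free V && ~~ (v <= V)%MS.
Proof.
have rE : \rank (col_mx v V) = \rank (v + V)%MS by rewrite addsmxE.
rewrite -[LHS]row_leq_rank rE -row_leq_rank.
case: (boolP (v <= V)%MS) => vV.
  have -> : \rank (v + V)%MS = \rank V by rewrite (addsmx_idPr vV).
  by rewrite andbF add1n ltnNge rank_leq_row.
rewrite andbT; apply/idP/idP => h.
  have := leq_trans h (mxrank_adds_leqif v V).1.
  by move/leq_trans/(_ (leq_add (rank_leq_row v) (leqnn _))); rewrite leq_add2l.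
rewrite add1n (leq_ltn_trans h) //.
have : (V < v + V)%MS by rewrite ltmxE addsmxSr /= addsmx_sub negb_and vV.
by rewrite ltmxErank => /andP[].
Qed.

Lemma card_diag_eigen (e : seq F) a :
  #|[set u : 'rV[F]_(size e) | u *m diag_seq e == a *: u]| = (#|F| ^ count_mem a e)%N.
Proof.
transitivity (\sum_(f : {ffun 'I_(size e) -> F}) \prod_i nat_of_bool (f i * e`_i == a * f i)%R)%N.
  rewrite -sum1_card (reindex (fun f : {ffun 'I_(size e) -> F} => \row_i f i)) /=; last first.
    exists (fun u : 'rV[F]_(size e) => [ffun i => u 0 i]) => [f _|u _].
      by apply/ffunP => i; rewrite ffunE mxE.
    by apply/rowP => i; rewrite mxE ffunE.
  rewrite big_mkcond; apply: eq_bigr => f _; rewrite inE mul_mx_diag.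
  case: eqP => [/rowP uE|uE].
    by rewrite big1 // => i _; have := uE i; rewrite !mxE => ->; rewrite eqxx.
  have /existsP[i /negPf ui] : [exists i, f i * e`_i != a * f i].
    rewrite -negb_forall; apply/forallP => fE; apply: uE; apply/rowP => i.
    by rewrite !mxE (eqP (fE i)).
  by rewrite (bigD1 i) //= ui mul0n.
rewrite -(bigA_distr_bigA (fun (i : 'I_(size e)) (c : F) => nat_of_bool (c * e`_i == a * c))) /=.
rewrite (eq_bigr (fun i : 'I_(size e) => if e`_i == a then #|F| else 1%N)); last first.
  move=> i _; case: eqP => [->|/eqP ea].
    by rewrite -sum1_card; apply: eq_bigr => c _; rewrite mulrC eqxx.
  rewrite (bigD1 0) //= mul0r mulr0 eqxx big1 // => c c0.
  by rewrite mulrC (inj_eq (mulIf c0)) (negPf ea).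
rewrite -big_mkcond (_ : (_ ^ _)%N = \prod_(x <- e | x == a) #|F|)%N.
  by rewrite [RHS](big_nth 0) big_mkord.
by rewrite big_const_seq iter_muln_1.
Qed.

Lemma card_eigen_sub k (D : 'M[F]_k) (V : 'M[F]_(k, n)) a :
  row_free V -> V *m A = D *m V ->
  #|[set v : 'rV[F]_n | (v *m A == a *: v) && (v <= V)%MS]| =
  #|[set u : 'rV[F]_k | u *m D == a *: u]|.
Proof.
move=> Vf VA; have inj := row_free_inj Vf.
rewrite -(card_imset _ (inj 1%N)); apply: eq_card => v; rewrite inE.
apply/andP/imsetP => [[/eqP vA /submxP[u vE]]|[u]].
  exists u => //; rewrite inE; apply/eqP/inj.
  by rewrite -mulmxA -VA mulmxA -vE vA -scalemxAl -vE.
rewrite inE => /eqP uD ->; split; last exact: submxMl.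
by rewrite -mulmxA VA mulmxA uD -scalemxAl.
Qed.

(** A frame is extended by any [a]-eigenvector outside its row space. Those inside correspond,
    through the injection given by [V], to eigenvectors of [diag_seq e], so their number depends
    only on the multiplicity of [a]. *)
Lemma card_eigenframes_cons (R : nzRingType) a (e : seq F) :
  #|eigenframes (a :: e)|%:R = #|eigenframes e|%:R *
    ((eigen_card a)%:R - #|F|%:R ^+ count_mem a e) :> R.
Proof.
have -> : #|eigenframes (a :: e)| = (\sum_(V in eigenframes e)
    #|[set v : 'rV[F]_n | (v *m A == a *: v) && ~~ (v <= V)%MS]|)%N.
  rewrite -sum1_card; under [RHS]eq_bigr => V _ do rewrite -sum1_card.
  rewrite pair_big_dep /=.
  rewrite (reindex (fun x : 'M[F]_(size e, n) * 'rV[F]_n =>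
    (col_mx x.2 x.1 : 'M[F]_(size (a :: e), n)))) /=; last first.
    exists (fun V : 'M[F]_(1 + size e, n) => (dsubmx V, usubmx V)) => [[V v] _|V _].
      by rewrite /= col_mxKd col_mxKu.
    exact: (@vsubmxK _ 1 (size e)).
  apply: eq_bigl => -[V v] /=; rewrite !inE row_free_col_mx1.
  have -> : (col_mx v V *m A == diag_seq (a :: e) *m (col_mx v V : 'M[F]_(size (a :: e), n))) =
      (v *m A == a *: v) && (V *m A == diag_seq e *m V).
    have -> : diag_seq (a :: e) *m (col_mx v V : 'M[F]_(size (a :: e), n)) =
        col_mx (a *: v) (diag_seq e *m V).
      apply/matrixP => i j; rewrite mul_diag_mx !mxE.
      by case: splitP => l il; rewrite ?(ord1 l) ?mul_diag_mx !mxE il ?(ord1 l).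
    rewrite mul_col_mx; apply/eqP/andP => [/eq_col_mx[-> ->] //|[/eqP -> /eqP ->] //].
  by rewrite -!andbA; congr (_ && _); rewrite andbC -!andbA; do ?bool_congr.
rewrite natr_sum -sum1_card natr_sum mulr_suml; apply: eq_bigr => V.
rewrite inE => /andP[Vf /eqP VA]; rewrite mul1r.
rewrite -natrX -card_diag_eigen -(card_eigen_sub a Vf VA) /eigen_card.
rewrite -(cardsID [set v : 'rV_n | (v <= V)%MS] [set v : 'rV_n | v *m A == a *: v]) natrD.
rewrite addrAC -natrB; last first.
  by apply/subset_leq_card/fintype.subsetP => v; rewrite !inE.
rewrite [X in (X - _)%N](_ : _ =
  #|[set v : 'rV[F]_n | (v *m A == a *: v) && (v <= V)%MS]|); last first.
  by apply: eq_card => v; rewrite !inE.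
by rewrite subnn add0r; congr _%:R; apply: eq_card => v; rewrite !inE andbC.
Qed.

Lemma card_eigenframes (R : comNzRingType) (e : seq F) :
  #|eigenframes e|%:R =
  \prod_a \prod_(i < count_mem a e) ((eigen_card a)%:R - #|F|%:R ^+ i) :> R.
Proof.
elim: e => [|a e IH].
  rewrite [RHS]big1 => [|a _]; last by rewrite big_ord0.
  rewrite (_ : eigenframes [::] = finset.setT) ?cardsT ?card_mx ?mul0n //.
  apply/finset.setP => V; rewrite !inE [V]flatmx0 /row_free mxrank0 eqxx.
  by rewrite mul0mx mulmx0 eqxx.
rewrite card_eigenframes_cons IH (bigD1 a) //= [RHS](bigD1 a) //= eqxx big_ord_recr /=.
rewrite mulrAC; congr (_ * _); apply: eq_bigr => b /negPf ba.
by rewrite eq_sym ba.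
Qed.

Lemma eigen_cardE a : eigen_card a = (#|F| ^ \rank (eigenspace A a))%N.
Proof.
rewrite -card_rowg; apply: eq_card => v; rewrite !inE.
by apply/eqP/eigenspaceP.
Qed.
End EigenFrames.

(** * The q-binomial sieve *)

Section Sieve.
Variable R : realFieldType.
Implicit Types (q x : R).

Definition qfall q x k : R := \prod_(i < k) (x - q ^+ i).

(** Newton interpolation coefficients at the nodes [1, q, q ^+ 2, ...] of the function that is 1 at
    the first node and 0 at all others. *)
Definition qcoef q k : R := (-1) ^+ k / \prod_(i < k) (q ^+ i.+1 - 1).

Definition qtrunc q K x : R := \sum_(k < K.+1) qcoef q k * qfall q x k.

Lemma prodrN_ord K (f : 'I_K -> R) : \prod_i - f i = (-1) ^+ K * \prod_i f i.
Proof. by rewrite prodrN card_ord. Qed.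

Lemma qtruncE q K x : (forall i, q ^+ i.+1 - 1 != 0) ->
  qtrunc q K x = \prod_(i < K) ((q ^+ i.+1 - x) / (q ^+ i.+1 - 1)).
Proof.
move=> q1; elim: K => [|K IH].
  by rewrite /qtrunc big_ord1 /qcoef /qfall !big_ord0 expr0 invr1 !mulr1.
rewrite /qtrunc big_ord_recr -/(qtrunc q K x) /= IH big_ord_recr /=.
rewrite /qcoef /qfall big_ord_recr big_ord_recl /=.
have -> : \prod_(i < K) (x - q ^+ bump 0 i) = (-1) ^+ K * \prod_(i < K) (q ^+ i.+1 - x).
  rewrite -prodrN_ord; apply: eq_bigr => i _.
  by rewrite opprB /bump leq0n add1n.
rewrite prodf_div expr0 exprS.
have s1 : (-1) ^+ K * (-1) ^+ K = 1 :> R by rewrite -exprMn mulrNN mulr1 expr1n.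
set S := (-1) ^+ K in s1 *; set U := \prod_(i < K) (q ^+ i.+1 - x).
set V := \prod_(i < K) (q ^+ i.+1 - 1); set Q := q ^+ K.+1.
have V0 : V != 0 by apply/prodf_neq0.
have Q0 : Q - 1 != 0 := q1 K.
(* The square of the sign [S] is kept formal for [field] and replaced by 1 afterwards. *)
transitivity (U / V - (S * S) * (x - 1) * U / (V * (Q - 1))); first by field; rewrite ?V0 ?Q0.
by rewrite s1; field; rewrite ?V0 ?Q0.
Qed.

Section Signs.
Variable q : R.
Hypothesis q_ge2 : 2 <= q.

Let q_gt1 : 1 < q.
Proof. exact: lt_le_trans (ltr1n _ 2) q_ge2. Qed.

Let qS_gt1 i : 1 <= q ^+ i.+1 - 1.
Proof.
rewrite lerBrDr exprS (_ : 1 + 1 = 2 * 1); last by rewrite mulr1.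
by rewrite ler_pM ?exprn_ege1 // ltW.
Qed.

Let qS_gt0 i : 0 < q ^+ i.+1 - 1.
Proof. exact: lt_le_trans ltr01 (qS_gt1 i). Qed.

Let qtruncE' K x : qtrunc q K x = \prod_(i < K) ((q ^+ i.+1 - x) / (q ^+ i.+1 - 1)).
Proof. by apply: qtruncE => i; rewrite gt_eqF. Qed.

Lemma qtrunc_expr0 K : qtrunc q K (q ^+ 0) = 1.
Proof. by rewrite qtruncE' big1 // => i _; rewrite expr0 divff ?gt_eqF. Qed.

(** In the product form a factor vanishes if [N < K]; otherwise none of the [K] factors is
    positive. *)
Lemma qtrunc_sign K N : 0 <= (-1) ^+ K * qtrunc q K (q ^+ N.+1).
Proof.
rewrite qtruncE' -prodrN_ord.
have [NK|KN] := ltnP N K.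
  by rewrite (bigD1 (Ordinal NK)) //= subrr mul0r oppr0 mul0r.
apply: prodr_ge0 => i _; rewrite -mulNr opprB divr_ge0 ?(ltW (qS_gt0 _)) // subr_ge0.
by rewrite ler_eXn2l // ltnS (leq_trans (ltnW (ltn_ord i))).
Qed.

Lemma qtrunc_even_ge j N : (N == 0)%:R <= qtrunc q j.*2 (q ^+ N).
Proof.
case: N => [|N]; first by rewrite qtrunc_expr0.
by have := qtrunc_sign j.*2 N; rewrite -mul2n exprM sqrrN expr1n expr1n mul1r.
Qed.

Lemma qtrunc_odd_le j N : qtrunc q j.*2.+1 (q ^+ N) <= (N == 0)%:R.
Proof.
case: N => [|N]; first by rewrite qtrunc_expr0.
have := qtrunc_sign j.*2.+1 N; rewrite exprS -mul2n exprM sqrrN expr1n expr1n.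
by rewrite mulr1 mulN1r oppr_ge0.
Qed.

(* Bonferroni: when some N a is positive, the odd truncation at a is nonpositive
   and the others are at most the even ones. *)
Lemma sieve_sandwich (I : finType) (N : I -> nat) j :
  let u a := qtrunc q j.*2 (q ^+ N a) in
  let l a := qtrunc q j.*2.+1 (q ^+ N a) in
  let g := [forall a, N a == 0]%:R in
  g <= \prod_a u a /\
  (\sum_a \prod_b (if b == a then l b else u b)) - (#|I|%:R - 1) * \prod_a u a <= g.
Proof.
move=> u l g.
have u0 a : 0 <= u a by apply: le_trans (qtrunc_even_ge j (N a)); apply: ler0n.
have lu a : l a <= u a := le_trans (qtrunc_odd_le j (N a)) (qtrunc_even_ge j (N a)).
rewrite /g; case: forallP => [N0|/forallP].
  have N0' a : N a = 0 by apply/eqP.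
  rewrite big1 => [|a _]; last by rewrite /u N0' qtrunc_expr0.
  split=> //; rewrite (eq_bigr (fun=> 1)) => [|a _].
    by rewrite sumr_const mulr1 opprB addrC subrK.
  by rewrite big1 // => b _; rewrite /u /l N0' !qtrunc_expr0 if_same.
rewrite negb_forall => /existsP[a0 Na0]; split; first exact: prodr_ge0.
rewrite subr_le0 (bigD1 a0) //=.
have h0 : \prod_b (if b == a0 then l b else u b) <= 0.
  rewrite (bigD1 a0) //= eqxx; apply: mulr_le0_ge0.
    by have := qtrunc_odd_le j (N a0); rewrite (negPf Na0).
  by apply: prodr_ge0 => b /negPf ->.
have hI : #|I|%:R - 1 = (\sum_(a | a != a0) 1) :> R.
  rewrite -[X in X - _ = _](sumr_const I) (bigD1 a0) //= addrAC subrr add0r.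
  by [].
rewrite hI mulr_suml -[leRHS]add0r lerD //; apply: ler_sum => a aa0.
rewrite mul1r (bigD1 a) //= [leRHS](bigD1 a) //= eqxx.
rewrite (eq_bigr u) => [|b /negPf -> //].
by rewrite ler_wpM2r // prodr_ge0.
Qed.

(** What the mean of [qtrunc q K] becomes once every q-factorial moment is replaced by its limit
    1. *)
Definition qsum K : R := \sum_(k < K.+1) qcoef q k.

Let qprod_ge k : k%:R <= \prod_(i < k) (q ^+ i.+1 - 1).
Proof.
case: k => [|k]; first by rewrite big_ord0.
rewrite big_ord_recr /= -[leLHS]mul1r ler_pM //; try exact: ler0n.
  by elim/big_rec: _ => // i y _ y1; apply: mulr_ege1.
rewrite lerBrDr natr1; apply: (@le_trans _ _ (2 ^+ k.+1)).
  by rewrite -natrX ler_nat ltn_expl.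
by rewrite lerXn2r ?nnegrE // ltW // (lt_trans ltr01).
Qed.

Let qprod_ge1 k : 1 <= \prod_(i < k) (q ^+ i.+1 - 1).
Proof. by elim/big_rec: _ => // i y _ y1; apply: mulr_ege1. Qed.

Lemma norm_qcoef_le k : (0 < k)%N -> `|qcoef q k| <= k%:R^-1.
Proof.
move=> k0; rewrite normrM normrX normrN1 expr1n mul1r normfV ger0_norm.
  by rewrite lef_pV2 ?posrE ?ltr0n // (lt_le_trans ltr01).
exact: le_trans ler01 _.
Qed.

(** Makes [qsum] an alternating sum with decreasing terms, whose even partial sums lie between
    [qsum 1] and 1. *)
Lemma norm_qcoefS k : `|qcoef q k.+1| <= `|qcoef q k|.
Proof.
rewrite !normrM !normrX normrN1 !expr1n !mul1r !normfV.
have pos i : 0 < \prod_(j < i) (q ^+ j.+1 - 1) := lt_le_trans ltr01 (qprod_ge1 i).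
by rewrite !(gtr0_norm (pos _)) lef_pV2 ?posrE ?pos // big_ord_recr ler_peMr ?(ltW (pos _)).
Qed.

Lemma qcoef_even j : qcoef q j.*2 = `|qcoef q j.*2|.
Proof.
rewrite ger0_norm // /qcoef -mul2n exprM sqrrN expr1n expr1n mul1r invr_ge0.
exact: le_trans ler01 _.
Qed.

Lemma qcoef_odd j : qcoef q j.*2.+1 = - `|qcoef q j.*2.+1|.
Proof.
rewrite ler0_norm ?opprK // /qcoef exprS -mul2n exprM sqrrN expr1n expr1n mulr1.
by rewrite mulN1r oppr_le0 invr_ge0; exact: le_trans ler01 _.
Qed.

Lemma qsumS K : qsum K.+1 = qsum K + qcoef q K.+1.
Proof. by rewrite /qsum big_ord_recr. Qed.

Lemma qsum_even_le1 j : qsum j.*2 <= 1.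
Proof.
elim: j => [|j IH].
  by rewrite /qsum double0 big_ord1 /qcoef big_ord0 expr0 divff ?oner_eq0.
rewrite doubleS !qsumS qcoef_odd -doubleS qcoef_even doubleS -addrA.
by apply: le_trans IH; rewrite gerDl addrC subr_le0 norm_qcoefS.
Qed.

Lemma qsum_odd_ge j : qsum 1 <= qsum j.*2.+1.
Proof.
elim: j => [//|j IH].
rewrite doubleS (qsumS j.*2.+2) (qsumS j.*2.+1) -doubleS qcoef_odd qcoef_even doubleS -addrA.
by apply: le_trans IH _; rewrite lerDl subr_ge0 norm_qcoefS.
Qed.

Lemma qsum1 : qsum 1 = 1 - (q - 1)^-1.
Proof.
rewrite /qsum big_ord_recr big_ord1 /= /qcoef big_ord0 big_ord1 expr0 expr1.
by rewrite divff ?oner_eq0 // mulN1r expr1.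
Qed.

Lemma qsum_even_ge j : 1 - (q - 1)^-1 <= qsum j.*2.
Proof.
rewrite -qsum1 (le_trans (qsum_odd_ge j)) // qsumS qcoef_odd gerDl oppr_le0.
exact: normr_ge0.
Qed.

Lemma qsum_even_ge0 j : 0 <= qsum j.*2.
Proof.
have q1 : 1 <= q - 1 by move: q_ge2; lra.
by rewrite (le_trans _ (qsum_even_ge j)) // subr_ge0 invf_le1 // (lt_le_trans ltr01).
Qed.

Lemma qsum2 : qsum 2 = 1 - (q ^+ 2 - 2) / ((q - 1) * (q ^+ 2 - 1)).
Proof.
rewrite (qsumS 1) qsum1 /qcoef !big_ord_recr big_ord0 /= expr1 mul1r sqrrN expr1n.
have q1 := lt0r_neq0 (qS_gt0 0); have q2 := lt0r_neq0 (qS_gt0 1).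
by rewrite expr1 in q1; field; rewrite q2.
Qed.
End Signs.
End Sieve.

(** * The sieve in terms of frame moments *)

Section Moments.
Variables (R : realFieldType) (F : finFieldType) (mu : F -> R).
Hypothesis mu_ge0 : forall a, 0 <= mu a.
Let q : R := #|F|%:R.

Definition mx_mean n (f : 'M[F]_n -> R) : R := \sum_A mx_mass mu A * f A.

Definition frame_moment (e : seq F) n : R := mx_mean (fun A : 'M[F]_n => #|eigenframes A e|%:R).

Definition eigenfree_mass n : R := mx_mean (fun A : 'M[F]_n => [forall a, ~~ eigenvalue A a]%:R).

Definition mult_seq K (h : {ffun F -> 'I_K}) : seq F :=
  flatten [seq nseq (h a) a | a <- enum F].

Lemma count_mult_seq K (h : {ffun F -> 'I_K}) a : count_mem a (mult_seq h) = h a.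
Proof.
rewrite /mult_seq count_flatten -map_comp sumnE big_map big_enum /= (bigD1 a) //=.
rewrite count_nseq /= eqxx mul1n big1 ?addn0 // => b /negPf ba.
by rewrite count_nseq /= ba.
Qed.

(** Expanding the product picks a multiplicity for each eigenvalue, and the resulting product of
    q-factorials counts eigenframes with these multiplicities. *)
Lemma prod_qfall_expand n (A : 'M[F]_n) K (w : F -> nat -> R) :
  \prod_a \sum_(k < K) w a k * qfall q (eigen_card A a)%:R k =
  \sum_(h : {ffun F -> 'I_K}) (\prod_a w a (h a)) * #|eigenframes A (mult_seq h)|%:R.
Proof.
rewrite bigA_distr_bigA /=; apply: eq_bigr => h _; rewrite big_split /=; congr (_ * _).
by rewrite card_eigenframes; apply: eq_bigr => a _; rewrite count_mult_seq.
Qed.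

Lemma mx_mean_expand n K (w : F -> nat -> R) :
  mx_mean (fun A : 'M[F]_n => \prod_a \sum_(k < K) w a k * qfall q (eigen_card A a)%:R k) =
  \sum_(h : {ffun F -> 'I_K}) (\prod_a w a (h a)) * frame_moment (mult_seq h) n.
Proof.
under [RHS]eq_bigr => h _ do rewrite mulr_sumr.
rewrite exchange_big; apply: eq_bigr => A _; rewrite prod_qfall_expand mulr_sumr.
by apply: eq_bigr => h _; rewrite mulrCA.
Qed.

Lemma mx_mean_le n (f g : 'M[F]_n -> R) : (forall A, f A <= g A) -> mx_mean f <= mx_mean g.
Proof.
move=> fg; apply: ler_sum => A _; apply: ler_wpM2l => //.
by apply: prodr_ge0 => i _; apply: prodr_ge0.
Qed.

(* Weights of the truncations of orders 2j and 2j+1, padded to a common length. *)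
Definition qweight j (b : bool) k : R :=
  if ~~ b && (k == j.*2.+1) then 0 else qcoef q k.

Lemma sum_qweight j b (f : nat -> R) :
  \sum_(k < j.*2.+2) qweight j b k * f k =
  \sum_(k < (if b then j.*2.+1 else j.*2).+1) qcoef q k * f k.
Proof.
case: b; first by apply: eq_bigr => k _; rewrite /qweight.
rewrite big_ord_recr /= /qweight /= eqxx mul0r addr0.
by apply: eq_bigr => k _; rewrite ltn_eqF.
Qed.

Definition sieve_upper j n : R :=
  \sum_(h : {ffun F -> 'I_(j.*2.+2)}) (\prod_a qweight j false (h a)) *
    frame_moment (mult_seq h) n.

Definition sieve_lower j n : R :=
  \sum_b (\sum_(h : {ffun F -> 'I_(j.*2.+2)}) (\prod_a qweight j (a == b) (h a)) *
    frame_moment (mult_seq h) n) - (q - 1) * sieve_upper j n.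

Lemma eigenfree_mass_sieve j n :
  sieve_lower j n <= eigenfree_mass n <= sieve_upper j n.
Proof.
have q2 : 2 <= q by rewrite ler_nat card_finNzRing_gt1.
have NE (A : 'M[F]_n) a : (eigen_card A a)%:R = q ^+ \rank (eigenspace A a).
  by rewrite eigen_cardE natrX.
have gE (A : 'M[F]_n) : [forall a, ~~ eigenvalue A a] =
    [forall a, \rank (eigenspace A a) == 0].
  by apply: eq_forallb => a; rewrite /eigenvalue negbK mxrank_eq0.
have S (A : 'M[F]_n) := sieve_sandwich q2 (fun a => \rank (eigenspace A a)) j.
rewrite /sieve_lower /sieve_upper.
under eq_bigr => b _ do rewrite -(mx_mean_expand _ _ (fun a k => qweight j (a == b) k)).
rewrite -(mx_mean_expand _ _ (fun _ k => qweight j false k)); apply/andP; split; last first.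
  apply: mx_mean_le => A; rewrite gE; apply: le_trans (S A).1 _.
  rewrite le_eqVlt; apply/orP; left; apply/eqP; apply: eq_bigr => a _.
  by rewrite (sum_qweight j false) NE.
have -> (f : F -> 'M[F]_n -> R) (g : 'M[F]_n -> R) (c : R) :
    \sum_b mx_mean (f b) - c * mx_mean g = mx_mean (fun A => \sum_b f b A - c * g A).
  rewrite /mx_mean exchange_big mulr_sumr -sumrB; apply: eq_bigr => A _.
  by rewrite -mulr_sumr mulrBr; congr (_ - _); rewrite mulrCA.
apply: mx_mean_le => A; rewrite gE; apply: le_trans _ (S A).2.
rewrite le_eqVlt; apply/orP; left; apply/eqP; congr (_ - _ * _).
  apply: eq_bigr => b _; apply: eq_bigr => a _.
  by rewrite sum_qweight NE eq_sym; case: eqP.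
by apply: eq_bigr => a _; rewrite (sum_qweight j false) NE.
Qed.

(** Evaluates the sieve sums with all frame moments set to 1: they factor over the eigenvalues. *)
Lemma sum_prod_qweight j (c : F -> bool) :
  \sum_(h : {ffun F -> 'I_(j.*2.+2)}) \prod_a qweight j (c a) (h a) =
  \prod_a qsum q (if c a then j.*2.+1 else j.*2).
Proof.
rewrite -(bigA_distr_bigA (fun a (k : 'I_(j.*2.+2)) => qweight j (c a) k)) /=.
apply: eq_bigr => a _; rewrite /qsum.
under eq_bigr do rewrite -[qweight _ _ _]mulr1.
by rewrite (sum_qweight j (c a) (fun=> 1)); apply: eq_bigr => k _; rewrite mulr1.
Qed.
End Moments.

Local Open Scope classical_set_scope.
Local Open Scope ring_scope.

(** * Limits over a fixed field *)

Lemma cvg_geometric0 (R : realType) (x : R) : 0 <= x -> x < 1 ->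
  x ^+ n @[n --> \oo] --> 0.
Proof. by move=> x0 x1; apply: cvg_expr; rewrite ger0_norm. Qed.

Lemma bernoulli_ge (R : realFieldType) (h : R) n : 0 <= h -> h <= 1 ->
  1 - n%:R * h <= (1 - h) ^+ n.
Proof.
move=> h0 h1; elim: n => [|n IH]; first by rewrite mul0r subr0.
rewrite exprS; apply: (@le_trans _ _ ((1 - h) * (1 - n%:R * h))); last first.
  by rewrite ler_wpM2l // subr_ge0.
have n0 : 0 <= n%:R :> R := ler0n _ _.
rewrite -natr1; nra.
Qed.

Lemma cvg_natmul_geometric0 (R : realType) (x : R) : 0 <= x -> x < 1 ->
  n.+1%:R * x ^+ n @[n --> \oo] --> 0.
Proof.
(* With [x = y ^+ 2], one factor [y ^+ n] absorbs [n.+1] by comparison with the geometric sum, and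
   the other tends to 0. *)
move=> x0 x1; pose y := Num.sqrt x.
have y0 : 0 <= y by apply: sqrtr_ge0.
have yx : x = y ^+ 2 by rewrite sqr_sqrtr.
have y1 : y < 1 by rewrite -(expr_lt1 (n := 2)) // -yx.
have y1' : 0 < 1 - y by rewrite subr_gt0.
have bound n : n.+1%:R * y ^+ n * (1 - y) <= 1 - y ^+ n.+1.
  elim: n => [|n IH]; first by rewrite expr0 expr1 !mul1r.
  have h : y ^+ n.+1 * (1 - y) <= 1 * (1 - y).
    by rewrite ler_wpM2r ?(ltW y1') // exprn_ile1 // ltW.
  have e : y ^+ n.+2 = y * y ^+ n.+1 by rewrite exprS.
  have e' : y ^+ n.+1 = y * y ^+ n by rewrite exprS.
  have := ler_wpM2l y0 IH; rewrite -!natr1.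
  move: h; rewrite e e'; nra.
apply: (@squeeze_cvgr _ _ _ _ (fun=> 0) (fun n => (1 - y)^-1 * y ^+ n)).
- apply: nearW => n; rewrite mulr_ge0 ?exprn_ge0 ?ler0n //=.
  rewrite yx -exprM mul2n -addnn exprD mulrA ler_wpM2r ?exprn_ge0 //.
  rewrite -(ler_pM2r y1') mulVf ?gt_eqF // (le_trans (bound n)) //.
  by rewrite gerBl exprn_ge0.
- exact: cvg_cst.
by rewrite -[0 in X in _ --> X](mulr0 (1 - y)^-1); apply: cvgMl_tmp; apply: cvg_geometric0.
Qed.

(** * Convergence of the frame moments to 1 *)

Section FrameMoment.
Variables (R : realType) (F : finFieldType) (mu : F -> R).
Hypothesis mu_ge0 : forall a, 0 <= mu a.
Hypothesis mu_sum1 : \sum_a mu a = 1.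
Variable q : R.
Hypothesis mu_le : forall a, mu a <= q.
Hypothesis q_lt1 : q < 1.
Variables (m : nat) (x : R).
Hypothesis m_gt0 : (0 < m)%N.
Hypothesis x_ge0 : 0 <= x.
Hypothesis x_lt1 : x < 1.
Hypothesis mixing : forall j N t t', (m * j <= N)%N ->
  `|walk_law mu N t - walk_law mu N t'| <= x ^+ j.

Lemma frame_moment_cvg (e : seq F) : frame_moment mu e @ \oo --> (1 : R).
Proof.
pose k := size e; pose G := #|'rV[F]_k|; pose g : R := G%:R.
have G_gt0 : (0 < G)%N by apply/card_gt0P; exists 0.
have g_ge1 : 1 <= g by rewrite ler1n.
have g_gt0 : 0 < g := lt_le_trans ltr01 g_ge1.
pose q' : R := Num.max q (1 - g^-1).
have q'1 : q' < 1 by rewrite gt_max q_lt1 gtrBl invr_gt0.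
have q'0 : 0 <= q'.
  by rewrite le_max (le_trans (mu_ge0 0)).
(* Gives [t * g = (1 - q') / 2], small enough that [q' * (1 + t * g)] is below 1; [y] below still
   bounds this product when [q'] is raised by at most [(1 - q') / 8]. *)
pose t : R := (1 - q') / (2 * g).
have t_gt0 : 0 < t by rewrite divr_gt0 ?subr_gt0 // mulr_gt0.
have tg : t * g = (1 - q') / 2.
  by rewrite /t; field; rewrite gt_eqF.
have t_le1 : t <= 1.
  have : t * 1 <= t * g by rewrite ler_wpM2l // ltW.
  by rewrite mulr1 tg => /le_trans; apply; lra.
pose y : R := (3 + q') / 4.
have y0 : 0 <= y by rewrite /y; lra.
have y1 : y < 1 by rewrite /y; lra.
pose C := (G * m)%N.
(* Over [L] columns the gain [y ^+ L] must beat the Chernoff loss [t ^- C] by a factor 2. *)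
have [L L_gt0 hL] : exists2 L, (0 < L)%N & y ^+ L <= t ^+ C / 2.
  have tC : 0 < t ^+ C / 2 by rewrite divr_gt0 // exprn_gt0.
  have /cvgrPdist_le /(_ _ tC) := cvg_geometric0 y0 y1.
  case=> N _ /(_ N.+1 (leqnSn N)) /=; rewrite sub0r normrN ger0_norm ?exprn_ge0 // => h.
  by exists N.+1.
(* The frequency threshold [m * j n] grows linearly in [n]: the oscillation [x ^+ j n] then decays
   exponentially, while the loss [t ^- (C * j n)] stays below the gain [y ^- n]. *)
pose j n := (n %/ L)%N.
have jcvg : j n @[n --> \oo] --> \oo := cvg_divnr _ L_gt0.
pose c : R := g * (g * #|F|%:R).
have c0 : 0 <= c by rewrite mulr_ge0 ?mulr_ge0 ?ler0n // ltW.
pose h n : R := c * x ^+ (j n).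
have h0 n : 0 <= h n by rewrite mulr_ge0 ?exprn_ge0.
have hE n : g * (g * (#|F|%:R * x ^+ (j n))) = h n by rewrite /h /c !mulrA.
have h_cvg : h n @[n --> \oo] --> 0.
  rewrite -[0 in X in _ --> X](mulr0 c); apply: cvgMl_tmp.
  exact: (cvg_comp _ _ jcvg (cvg_geometric0 x_ge0 x_lt1)).
have nh_cvg : n%:R * h n @[n --> \oo] --> 0.
  apply: (@squeeze_cvgr _ _ _ _ (fun=> 0)
    (fun n => (L%:R * c) * ((j n).+1%:R * x ^+ (j n)))).
  - apply: nearW => n; rewrite mulr_ge0 ?ler0n //=.
    rewrite /h [leRHS]mulrACA ler_wpM2r ?mulr_ge0 ?exprn_ge0 //.
    by rewrite -natrM ler_nat mulnC ltnW // ltn_ceil.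
  - exact: cvg_cst.
  rewrite -[0 in X in _ --> X](mulr0 (L%:R * c)); apply: cvgMl_tmp.
  exact: (cvg_comp _ _ jcvg (cvg_natmul_geometric0 x_ge0 x_lt1)).
pose bad n : R := ((q' + h n) * (1 + t * g)) ^+ n / t ^+ (C * j n).
have bad_cvg : bad n @[n --> \oo] --> 0.
  apply: (@squeeze_cvgr _ _ _ _ (fun=> 0) (fun n => 2^-1 ^+ j n)).
  - have e1 : 0 < (1 - q') / 8 by rewrite divr_gt0 // subr_gt0.
    near=> n.
    have hn : h n <= (1 - q') / 8.
      rewrite -[h n]ger0_norm // -normrN -sub0r.
      by near: n; move/cvgrPdist_le : h_cvg; apply.
    have yn : (q' + h n) * (1 + t * g) <= y.
      rewrite tg /y; apply: (@le_trans _ _ ((q' + (1 - q') / 8) * (1 + (1 - q') / 2))).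
        by rewrite ler_wpM2r ?lerD2l // addr_ge0 // divr_ge0 // subr_ge0 ltW.
      have s0 : 0 <= (1 - q') * (1 - q') by rewrite mulr_ge0 // subr_ge0 ltW.
      rewrite -subr_ge0 (_ : _ - _ = (1 - q') / 8 + 7 / 16 * ((1 - q') * (1 - q'))); last by field.
      by rewrite addr_ge0 ?mulr_ge0 // subr_ge0 ltW.
    have yn0 : 0 <= (q' + h n) * (1 + t * g).
      by rewrite mulr_ge0 ?addr_ge0 // ltW // mulr_gt0.
    rewrite /bad divr_ge0 ?exprn_ge0 ?(ltW t_gt0) //=.
    rewrite exprM ler_pdivrMr ?exprn_gt0 // -exprMn [2^-1 * _]mulrC.
    apply: (@le_trans _ _ (y ^+ n)); first by rewrite lerXn2r ?nnegrE.
    apply: (@le_trans _ _ (y ^+ (L * j n))).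
      by rewrite ler_wiXn2l // ?(ltW y1) // mulnC leq_divM.
    by rewrite exprM lerXn2r ?nnegrE ?exprn_ge0 // divr_ge0 // exprn_ge0 // ltW.
  - exact: cvg_cst.
  have half1 : 2^-1 < 1 :> R by rewrite invf_lt1 ?ltr1n.
  have half0 : 0 <= 2^-1 :> R by rewrite invr_ge0.
  exact: (cvg_comp _ _ jcvg (cvg_geometric0 half0 half1)).
pose K : R := #|{set 'rV[F]_k}|%:R.
have Kbad_cvg : K * bad n @[n --> \oo] --> 0.
  by rewrite -[0 in X in _ --> X](mulr0 K); apply: cvgMl_tmp.
(* [h n] is [g * eps] for this threshold. Its [n]-th power bounds are linearized by Bernoulli below
   and by [1 + h <= expR h] above, so [n%:R * h n] tending to 0 suffices. *)
apply: (@squeeze_cvgr _ _ _ _ (fun n => (1 - n%:R * h n) - K * bad n)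
  (fun n => expR (n%:R * h n) + K * bad n)); last 2 first.
- rewrite -[1 in X in _ --> X](subr0 1) -[1 in X in _ --> X](subr0 1).
  by apply: cvgB => //; apply: cvgB => //; apply: cvg_cst.
- rewrite -[1 in X in _ --> X](addr0 1); apply: cvgD => //.
  rewrite -[1 in X in _ --> X](@expR0 R).
  exact: (cvg_comp _ _ nh_cvg (@continuous_expR R 0)).
near=> n.
have hn : h n <= 1.
  rewrite -[h n]ger0_norm // -normrN -sub0r.
  by near: n; move/cvgrPdist_le : h_cvg; apply.
have jn : (0 < j n)%N by near: n; exists L => // n Ln; rewrite /j divn_gt0.
have osc N u u' : (m * j n <= N)%N -> `|walk_law mu N u - walk_law mu N u'| <= x ^+ (j n).
  exact: mixing.
have mu_le' a : mu a <= q' by rewrite le_max mu_le.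
have q'g : 1 - g^-1 <= q' by rewrite le_max lexx orbT.
have mE : frame_moment mu e n = \sum_(V : 'M[F]_(k, n) | row_free V)
    \prod_j comb_law mu (rows V^T) (row j (diag_seq e *m V)^T).
  exact: mx_mass_intertwiner.
have := @intertwiner_sum_le _ _ _ mu_ge0 mu_sum1 k n _ _ q' t (diag_seq e)
  osc mu_le' t_gt0 t_le1.
have := @intertwiner_sum_ge _ _ _ mu_ge0 mu_sum1 k n _ _ q' t (diag_seq e)
  osc mu_le' q'g t_gt0 t_le1.
rewrite /= -mE -/G -/g hE -/K mulnA -/C -/(bad n) muln_gt0 m_gt0 => /(_ jn hn) lo hi.
rewrite (le_trans hi) ?andbT.
  by rewrite (le_trans _ lo) // lerD2r bernoulli_ge.
rewrite lerD2r expRM_natl lerXn2r ?nnegrE ?addr_ge0 ?expR_ge0 //.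
exact: expR_ge1Dx.
Unshelve. all: by end_near.
Qed.
End FrameMoment.

(** Since [q < 1] there are two distinct atoms [a0] and [a1]. The sums of [p.-1] terms taken from
    them form an arithmetic progression of [p] terms with nonzero difference, hence reach every
    residue. *)
Lemma Fp_mixing (R : realFieldType) (p : nat) (mu : 'F_p -> R) (q : R) :
  prime p -> (forall a, 0 <= mu a) -> \sum_a mu a = 1 ->
  (forall a, mu a <= q) -> q < 1 ->
  exists x : R, [/\ 0 <= x, x < 1 & forall j N t t', (p.-1 * j <= N)%N ->
    `|walk_law mu N t - walk_law mu N t'| <= x ^+ j].
Proof.
move=> p_pr mu0 mu1 muq q1.
have mu_le1 a : mu a <= 1 := le_trans (muq a) (ltW q1).
have atom (A : pred 'F_p) : 0 < \sum_(a | A a) mu a -> exists2 a, A a & 0 < mu a.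
  move=> sum_gt0; have [/existsP[a /andP[]]|] := boolP [exists a, A a && (0 < mu a)].
    by exists a.
  rewrite negb_exists => /forallP muA; move: sum_gt0; rewrite ltNge => /negP[].
  by apply: sumr_le0 => a Aa; have := muA a; rewrite Aa -leNgt.
have [a0 _ a0_gt0] : exists2 a, xpredT a & 0 < mu a by apply: atom; rewrite mu1.
have [a1 a10 a1_gt0] : exists2 a, a != a0 & 0 < mu a.
  apply: atom; move: mu1; rewrite (bigD1 a0) //= => /(canRL (addKr _)) ->.
  by rewrite addrC subr_gt0 (le_lt_trans (muq a0)).
(* One bound for all mixed products: both exponents are raised to [p.-1], as atoms are at most 1. *)
pose eta := mu a0 ^+ p.-1 * mu a1 ^+ p.-1.
have eta0 : 0 < eta by rewrite mulr_gt0 // exprn_gt0.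
have eta_le c : eta <= walk_law mu p.-1 c.
  pose z := (c - a0 *+ p.-1) / (a1 - a0).
  have zp : (z <= p.-1)%N.
    by rewrite -ltnS prednK ?prime_gt0 // -[leqRHS](Fp_cast p_pr) ltn_ord.
  have cE : c = a1 *+ z + a0 *+ (p.-1 - z).
    rewrite mulrnBr // addrCA -mulrnBl addrC.
    rewrite -[_ *+ nat_of_ord z]mulr_natr natr_Zp mulrC divfK ?subrK //.
    by rewrite subr_eq0.
  have := walk_law_two_atoms mu0 a0 a1 z (p.-1 - z); rewrite subnKC // -cE.
  apply: le_trans; rewrite /eta mulrC ler_pM ?exprn_ge0 //.
    by rewrite ler_wiXn2l.
  by rewrite ler_wiXn2l // leq_subr.
exists (1 - #|'F_p|%:R * eta); split.
- rewrite subr_ge0 -[leRHS](walk_law_sum1 mu1 p.-1) mulr_natl -sumr_const.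
  by apply: ler_sum => a _; apply: eta_le.
- by rewrite gtrBl mulr_gt0 // ltr0n; apply/card_gt0P; exists 0.
by move=> j N t t'; apply: walk_law_mixing => //; apply: ltW.
Qed.

(** Every lower limit is at most every upper limit, so the supremum of the lower ones separates
    them, and closing gaps force convergence to it. *)
Lemma cvg_nested_sandwich (R : realType) (u : R^nat) (lo hi : nat -> R^nat) (a b : R^nat) :
  (forall j n, lo j n <= u n <= hi j n) ->
  (forall j, lo j @ \oo --> a j) -> (forall j, hi j @ \oo --> b j) ->
  b j - a j @[j --> \oo] --> 0 ->
  exists l, u @ \oo --> l /\ forall j, a j <= l <= b j.
Proof.
move=> lohi loa hib ba0.
have ab i j : a i <= b j.
  apply: ler_cvg_to (loa i) (hib j) _; apply: nearW => n.
  by have /andP[+ _] := lohi i n; have /andP[_] := lohi j n; move=> h1 h2; apply: le_trans h1.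
have hL j : a j <= sup (range a) <= b j.
  apply/andP; split.
    by apply: ub_le_sup; [exists (b 0%N) => _ [i _ <-] | exists j].
  by apply: ge_sup; [exists (a 0%N), 0%N | move=> _ [i _ <-]].
exists (sup (range a)); split=> //; apply/cvgrPdist_le => e e0.
have e2 : 0 < e / 2 by rewrite divr_gt0.
have /cvgrPdist_le/(_ _ e2)[j _ /(_ j (leqnn j)) /=] := ba0.
rewrite sub0r normrN => dj.
near=> n.
have h1 : `|a j - lo j n| <= e / 2 by near: n; move/cvgrPdist_le : (loa j); apply.
have h2 : `|b j - hi j n| <= e / 2 by near: n; move/cvgrPdist_le : (hib j); apply.
have /andP[l1 l2] := lohi j n; have /andP[L1 L2] := hL j.
move: dj h1 h2 l1 l2 L1 L2; rewrite !ler_norml => /andP[d1 d2] /andP[h1 h2] /andP[h3 h4] *.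
by apply/andP; split; lra.
Unshelve. all: by end_near.
Qed.

Section FixedField.
Variables (R : realType) (F : finFieldType) (mu : F -> R).
Hypothesis mu_ge0 : forall a, 0 <= mu a.
Hypothesis frame_cvg : forall e, frame_moment mu e @ \oo --> (1 : R).
Let q : R := #|F|%:R.
Let s j := qsum q j.*2.
Let c j := `|qcoef q j.*2.+1|.

Let q_ge2 : 2 <= q.
Proof. by rewrite ler_nat card_finNzRing_gt1. Qed.

Let frame_sum_cvg (I : finType) (w : I -> R) (e : I -> seq F) :
  (fun n => \sum_(h : I) w h * frame_moment mu (e h) n) @ \oo --> \sum_h w h.
Proof.
apply: cvg_big => [|h _]; first exact: add_continuous.
by rewrite -[w h in X in _ --> X]mulr1; apply: cvgMl_tmp.
Qed.

Lemma sieve_upper_cvg j : sieve_upper mu j @ \oo --> s j ^+ #|F|.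
Proof.
rewrite -prodr_const -(sum_prod_qweight R j (fun=> false)).
exact: frame_sum_cvg.
Qed.

Lemma sieve_lower_cvg j :
  sieve_lower mu j @ \oo --> s j ^+ #|F|.-1 * (s j - q * c j).
Proof.
have F0 : (0 < #|F|)%N by apply/card_gt0P; exists 0.
have -> : s j ^+ #|F|.-1 * (s j - q * c j) =
    \sum_(b : F) (s j ^+ #|F|.-1 * (s j - c j)) - (q - 1) * s j ^+ #|F|.
  rewrite sumr_const -mulr_natl -/q -(prednK F0) exprS /=; ring.
apply: cvgB; last by apply: cvgMl_tmp; apply: sieve_upper_cvg.
apply: cvg_big => [|b _]; first exact: add_continuous.
have -> : s j ^+ #|F|.-1 * (s j - c j) =
    \sum_(h : {ffun F -> 'I_(j.*2.+2)}) \prod_a qweight R F j (a == b) (h a).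
  rewrite (sum_prod_qweight R j (eq_op^~ b)) (bigD1 b) //= eqxx mulrC; congr (_ * _).
    by rewrite qsumS qcoef_odd.
  rewrite (eq_bigr (fun=> s j)) => [|a /negPf -> //].
  by rewrite prodr_const cardC1.
exact: frame_sum_cvg.
Qed.

(** The limits of the two sieve bounds differ by at most [q * c j], which is at most [q / j.+1%:R]
    and so tends to 0. *)
Lemma eigenfree_mass_cvg : exists l, eigenfree_mass mu @ \oo --> l /\
  forall j, s j ^+ #|F| - q * c j <= l <= s j ^+ #|F|.
Proof.
have q0 : 0 <= q by apply: ler0n.
have c0 j : 0 <= c j by apply: normr_ge0.
have s0 j : 0 <= s j by apply: qsum_even_ge0.
have s1 j : s j <= 1 by apply: qsum_even_le1.
have F0 : (0 < #|F|)%N by apply/card_gt0P; exists 0.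
have gapE j : s j ^+ #|F| - s j ^+ #|F|.-1 * (s j - q * c j) = s j ^+ #|F|.-1 * (q * c j).
  by rewrite -{1}(prednK F0) exprSr; ring.
have gap_le j : s j ^+ #|F|.-1 * (q * c j) <= q * c j.
  by rewrite ler_piMl ?mulr_ge0 // exprn_ile1.
have [] := @cvg_nested_sandwich R (eigenfree_mass mu) (sieve_lower mu) (sieve_upper mu)
  (fun j => s j ^+ #|F|.-1 * (s j - q * c j)) (fun j => s j ^+ #|F|).
- by move=> j n; apply: eigenfree_mass_sieve.
- exact: sieve_lower_cvg.
- exact: sieve_upper_cvg.
- apply: (@squeeze_cvgr _ _ _ _ (fun=> 0) (fun j => q * j.+1%:R^-1)).
  + apply: nearW => j; rewrite gapE mulr_ge0 ?exprn_ge0 ?mulr_ge0 //=.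
    apply: le_trans (gap_le j) _; rewrite ler_wpM2l //.
    apply: le_trans (norm_qcoef_le q_ge2 _) _ => //.
    by rewrite lef_pV2 ?posrE ?ltr0n // ler_nat ltnS -addnn leq_addr.
  + exact: cvg_cst.
  rewrite -[0 in X in _ --> X](mulr0 q); apply: cvgMl_tmp; exact: cvg_harmonic.
move=> l [ul hl]; exists l; split=> // j; have /andP[lo ->] := hl j; rewrite andbT.
by apply: le_trans lo; have := gap_le j; rewrite -gapE; lra.
Qed.
End FixedField.

(** * Large fields, and passage to the probability space *)

(** For [q >= 4], [qsum q 2] lies between [1 - (q - 1)^-1] and [1 - q^-1]; its [n]-th power is
    compared with exponentials by [1 + x <= expR x]. The constants 6 and 3 absorb the passage to
    [n.+1%:R^-1], whose limit is that of the harmonic sequence. *)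
Lemma field_limit_bounds (R : realType) (q : R) (n : nat) (l : R) :
  q = n%:R -> (4 <= n)%N ->
  qsum q 2 ^+ n - q * `|qcoef q 3| <= l <= qsum q 2 ^+ n ->
  expR (- (1 + 6 * n.+1%:R^-1)) - 3 * n.+1%:R^-1 <= l <= expR (- 1).
Proof.
move=> qE n4 /andP[lo hi].
have q4 : 4 <= q by rewrite qE (ler_nat _ 4 n).
have q2 : 2 <= q by rewrite (le_trans _ q4) // ler_nat.
have nq : n.+1%:R = q + 1 by rewrite qE natr1.
have q1_gt0 : 0 < q - 1 by rewrite subr_gt0 (lt_le_trans _ q4) // ltr1n.
have q2_gt0 : 0 < q - 2 by rewrite subr_gt0 (lt_le_trans _ q4) // ltr_nat.
have qp_gt0 : 0 < q + 1 by rewrite addr_gt0 // (lt_le_trans _ q4).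
have qq_gt0 : 0 < q ^+ 2 - 1.
  by rewrite (_ : q ^+ 2 - 1 = (q - 1) * (q + 1)) ?mulr_gt0 //; ring.
have s0 : 0 <= qsum q 2 := qsum_even_ge0 q2 1.
apply/andP; split; last first.
  apply: le_trans hi _.
  have -> : -1 = n%:R * - q^-1 :> R by rewrite -qE mulrN divff // gt_eqF // (lt_le_trans _ q4).
  rewrite expRM_natl lerXn2r ?nnegrE ?expR_ge0 //.
  apply: le_trans (expR_ge1Dx _); rewrite (qsum2 q2) lerD2l lerN2.
  rewrite ler_pdivlMr ?mulr_gt0 // ler_pdivrMl ?(lt_le_trans _ q4) //.
  rewrite -subr_ge0 (_ : _ - _ = q * (q - 4) + 3 * (q - 4) + 11); last by ring.
  by rewrite !addr_ge0 ?mulr_ge0 ?subr_ge0 // (le_trans _ q4).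
apply: le_trans lo; apply: lerB.
  apply: (@le_trans _ _ ((1 - (q - 1)^-1) ^+ n)); last first.
    rewrite lerXn2r ?nnegrE ?(qsum_even_ge q2 1) // subr_ge0 invf_le1 //.
    by rewrite lerBrDr (le_trans _ q2).
  have e2 : 0 < (q - 2)^-1 by rewrite invr_gt0.
  have -> : 1 - (q - 1)^-1 = (1 + (q - 2)^-1)^-1.
    have h : q - 2 + 1 != 0 by rewrite (_ : q - 2 + 1 = q - 1) ?gt_eqF //; ring.
    by field; rewrite h !gt_eqF.
  apply: (@le_trans _ _ (expR (n%:R * - (q - 2)^-1))).
    rewrite ler_expR mulrN lerN2 -qE nq.
    rewrite ler_pdivrMr // mulrDl mul1r -lerBlDl opprB addrC subrK.
    rewrite mulrAC ler_pdivlMr //; lra.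
  rewrite expRM_natl lerXn2r ?nnegrE ?expR_ge0 ?invr_ge0 ?addr_ge0 ?invr_ge0 ?(ltW q2_gt0) //.
  rewrite expRN lef_pV2 ?posrE ?expR_gt0 ?addr_gt0 //.
  exact: expR_ge1Dx.
have h2 : `|qcoef q 3| <= ((q - 1) * (q ^+ 2 - 1))^-1.
  apply: le_trans (norm_qcoefS q2 2) _.
  rewrite /qcoef !big_ord_recr big_ord0 /= sqrrN expr1n !mul1r expr1.
  by rewrite gtr0_norm // invr_gt0 mulr_gt0.
apply: (@le_trans _ _ (q * ((q - 1) * (q ^+ 2 - 1))^-1)).
  by rewrite ler_wpM2l // (le_trans _ q4).
rewrite nq ler_pdivrMr ?mulr_gt0 // mulrAC ler_pdivlMr //.
rewrite (_ : 3 * _ = (q + 1) * (3 * (q - 1) ^+ 2)); last by ring.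
rewrite mulrC ler_wpM2l ?(ltW qp_gt0) //.
rewrite -subr_ge0 (_ : _ - _ = 3 * q * (q - 4) + 5 * (q - 4) + 23); last by ring.
by rewrite !addr_ge0 ?mulr_ge0 ?subr_ge0 // (le_trans _ q4).
Qed.

(** * From the probability space to sums over matrices *)

Section FiniteValued.
Variables (d : measure_display) (T : measurableType d) (R : realType).
Variables (P : probability T R) (I : finType) (f : T -> I).
Hypothesis mf : forall a, measurable (f @^-1` [set a]).

Lemma finite_valued_prob (A : pred I) :
  (P [set w | A (f w)] = \sum_(a | A a) P (f @^-1` [set a]))%E.
Proof.
have main s : uniq s -> measurable [set w | f w \in s] /\
    (P [set w | f w \in s] = \sum_(a <- s) P (f @^-1` [set a]))%E.
  elim: s => [_|a s IH /= /andP[as_ us]].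
    rewrite big_nil (_ : [set w | f w \in [::]] = set0) ?measure0; last first.
      by apply/seteqP; split.
    by split.
  have [ms Ps] := IH us.
  have -> : [set w | f w \in a :: s] = (f @^-1` [set a]) `|` [set w | f w \in s].
    apply/seteqP; split => w /=; rewrite inE.
      by case/orP => [/eqP|]; [left|right].
    by case=> [->|->]; rewrite ?eqxx ?orbT.
  split; first exact: measurableU.
  rewrite big_cons -Ps; apply: measureU => //.
  by apply/seteqP; split => // w /= [-> ws]; rewrite ws in as_.
have [_] := main (enum A) (enum_uniq _).
rewrite big_enum /= => <-; congr (P _).
by apply/seteqP; split => w /=; rewrite mem_enum.
Qed.
End FiniteValued.

Lemma balanced_atoms (d : measure_display) (T : measurableType d) (R : realType)
    (P : probability T R) p (alpha : R) (X : T -> 'F_p) :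
  discrete_rv X -> balanced P alpha X ->
  let mu a := fine (P (X @^-1` [set a])) in
  [/\ forall a, 0 <= mu a, \sum_a mu a = 1 & forall a, mu a <= 1 - alpha].
Proof.
move=> mX bX mu.
have muE a : P (X @^-1` [set a]) = (mu a)%:E.
  by rewrite fineK // fin_num_measure.
split=> [a||a].
- by rewrite fine_ge0.
- apply: EFin_inj; rewrite -sumEFin; under eq_bigr do rewrite -muE.
  rewrite -(finite_valued_prob P (fun a => mX [set a]) predT) -(probability_setT P).
  by congr (P _); apply/seteqP; split.
rewrite -lee_fin -muE; apply: le_trans bX.
exact: (@le_bigmax _ _ _ _ (fun a => P (X @^-1` [set a]))).
Qed.

Lemma eigenvalue_free_prob (R : realType) (d1 d2 : measure_display)
    (T1 : measurableType d1) (T2 : measurableType d2)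
    (P1 : probability T1 R) (P2 : probability T2 R) (F : finFieldType) n
    (M : T1 -> 'M[F]_n) (xi : T2 -> F) :
  discrete_rv xi -> iid_copies_entries P1 P2 M xi ->
  P1 [set w | eigenvalue_free (M w)] =
    (eigenfree_mass (fun a => fine (P2 (xi @^-1` [set a]))) n)%:E.
Proof.
move=> mxi [mM dM iM].
(* Independence over the full index set turns this intersection into the product [mx_mass]. *)
have preE A : M @^-1` [set A] = \bigcap_(ij in [set` [set: 'I_n * 'I_n]%SET])
    (fun w => M w ij.1 ij.2) @^-1` [set A ij.1 ij.2].
  apply/seteqP; split => w /= => [<- //|MA].
  by apply/matrixP => i j; apply: (MA (i, j)); rewrite /= inE.
have massE A : P1 (M @^-1` [set A]) =
    (mx_mass (fun a => fine (P2 (xi @^-1` [set a]))) A)%:E.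
  rewrite preE iM /mx_mass pair_big -prodEFin; apply: eq_big => [ij|ij _].
    by rewrite inE.
  by rewrite dM fineK // fin_num_measure.
have mpre A : measurable (M @^-1` [set A]).
  by rewrite preE; apply: fin_bigcap_measurable => // ij _; apply: mM.
have -> : [set w | eigenvalue_free (M w)] =
    [set w | [forall a, ~~ eigenvalue (M w) a]].
  by apply/seteqP; split => w /= /forallP.
rewrite (finite_valued_prob P1 mpre (fun A => [forall a, ~~ eigenvalue A a])).
rewrite /eigenfree_mass /mx_mean big_mkcond -sumEFin; apply: eq_bigr => A _.
by rewrite massE; case: ifP; rewrite ?mulr1 ?mulr0.
Qed.

Theorem theorem1p8 (R : realType) (alpha : R) (halpha : 0 < alpha)
    (dX : nat -> measure_display)
    (X : forall p : nat, measurableType (dX p))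
    (Q : forall p : nat, probability (X p) R)
    (xi : forall p : nat, X p -> 'F_p)
    (hxi : forall p : nat, prime p ->
       discrete_rv (xi p) /\ balanced (Q p) alpha (xi p))
    (d : nat -> nat -> measure_display)
    (T : forall n p : nat, measurableType (d n p))
    (P : forall n p : nat, probability (T n p) R)
    (M : forall n p : nat, T n p -> 'M['F_p]_n)
    (hM : forall n p : nat, prime p ->
       iid_copies_entries (P n p) (Q p) (M n p) (xi p)) :
  (forall p : nat, prime p ->
     cvgn (fun n : nat => P n p [set w | eigenvalue_free (M n p w)])) /\
  (fun p : nat => limn (fun n : nat => P n p [set w | eigenvalue_free (M n p w)]))
    @ within [set p : nat | prime p] \oo --> (expR 1)^-1%:E.
Proof.
have limP p : prime p -> exists l : R,
    (P n p [set w | eigenvalue_free (M n p w)] @[n --> \oo] --> l%:E) /\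
    ((4 <= p)%N -> expR (- (1 + 6 * p.+1%:R^-1)) - 3 * p.+1%:R^-1 <= l <= expR (- 1)).
  move=> p_pr; have [dxi bxi] := hxi p p_pr.
  pose mu a := fine (Q p (xi p @^-1` [set a])).
  have [mu0 mu1 mule] : [/\ forall a, 0 <= mu a, \sum_a mu a = 1 &
    forall a, mu a <= 1 - alpha] := balanced_atoms dxi bxi.
  have alpha1 : 1 - alpha < 1 by rewrite gtrBl.
  have [x [x0 x1 mix]] := Fp_mixing p_pr mu0 mu1 mule alpha1.
  have p1_gt0 : (0 < p.-1)%N by rewrite -subn1 subn_gt0 prime_gt1.
  have frame e := frame_moment_cvg mu0 mu1 mule alpha1 p1_gt0 x0 x1 mix e.
  have [l [ul hl]] := eigenfree_mass_cvg mu0 frame.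
  exists l; split; last first.
    move=> p4; apply: (field_limit_bounds (q := #|'F_p|%:R)) p4 _.
      by rewrite card_Fp.
    (* Truncations of orders 2 and 3 already give bounds whose common limit is [expR (- 1)] for
       large [p]. *)
    by have := hl 1%N; rewrite [X in _ ^+ X](card_Fp p_pr).
  rewrite (_ : (fun n => _) = EFin \o eigenfree_mass mu).
    by apply: cvg_EFin => //; apply: nearW.
  by apply/funext => n /=; apply: (eigenvalue_free_prob dxi (hM n p p_pr)).
split=> [p p_pr|].
  by have [l [hl _]] := limP p p_pr; apply/cvg_ex; exists l%:E.
have limE p : prime p -> exists2 l : R,
    limn (fun n : nat => P n p [set w | eigenvalue_free (M n p w)]) = l%:E &
    ((4 <= p)%N -> expR (- (1 + 6 * p.+1%:R^-1)) - 3 * p.+1%:R^-1 <= l <= expR (- 1)).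
  by move=> p_pr; have [l [hl bl]] := limP p p_pr; exists l => //; apply: cvg_lim.
have near4 : \forall p \near within [set p : nat | prime p] \oo, prime p /\ (4 <= p)%N.
  by exists 4%N => // p p4 p_pr; split.
rewrite -expRN; apply: cvg_EFin.
  by apply: filterS near4 => p [p_pr _]; have [l -> _] := limE p p_pr.
apply: (@squeeze_cvgr _ _ _ _
  (fun p : nat => expR (- (1 + 6 * p.+1%:R^-1)) - 3 * p.+1%:R^-1) (fun=> expR (- 1))).
- apply: filterS near4 => p [p_pr p4] /=.
  by have [l -> /(_ p4)] := limE p p_pr.
(* The lower bound converges along all naturals, hence along the primes. *)
- apply: cvg_within_filter.
  have h c : (fun p : nat => c * p.+1%:R^-1) @ \oo --> (0 : R).
    by rewrite -[0 in X in _ --> X](mulr0 c); apply: cvgMl_tmp; apply: cvg_harmonic.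
  have hN : (fun p : nat => - (1 + 6 * p.+1%:R^-1)) @ \oo --> (- 1 : R).
    apply: cvgN; rewrite -[1 in X in _ --> X]addr0.
    by apply: cvgD; [apply: cvg_cst | apply: h].
  rewrite -[expR _ in X in _ --> X]subr0; apply: cvgB; last exact: h.
  exact: (cvg_comp _ _ hN (@continuous_expR R (- 1))).
exact: cvg_cst.
Qed.
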